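(* Let $\mu>0$ and $k_0,k_1\in\mathbb{R}$ be fixed. There exists a constant $C>0$ such that for any $\mathbf{u}\in\mathcal{W}$, $$\|\mathbf{u}\|^2_{L^\infty(\Omega)}\le C\|\mathbf{u}\|_{L^2(\Omega)}\|\mathbf{u}\|_{H^2(\Omega)}.$$
   Context: $\Omega:=\mathbb{R}\times(0,1)\subset\mathbb{R}^2$; $\mathbf{n}$ is the unit outer normal and $\tau$ a unit tangent vector on $\partial\Omega$; $\mathbb{D}(\mathbf{v})=\frac12(\nabla\mathbf{v}+\nabla^T\mathbf{v})$. The slip coefficient $k$ on $\partial\Omega$ is given by $k(x,1)=k_1$, $k(x,0)=k_0$. Set $\mathbf{V}:=\{\mathbf{v}\in H^1(\Omega)^2:\nabla\cdot\mathbf{v}=0,\ \mathbf{v}\cdot\mathbf{n}=0\text{ on }\partial\Omega\}$ and $\mathcal{W}:=\{\mathbf{v}\in\mathbf{V}\cap H^2(\Omega)^2: 2\mu\mathbb{D}(\mathbf{v})\mathbf{n}\cdot\tau=k(x,y)\mathbf{v}\cdot\tau\text{ on }\partial\Omega\}$. *)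

(* Defs.v *)
(* MathComp-Analysis, over an arbitrary [R : realType]. *)
From HB Require Import structures.
From mathcomp Require Import all_boot all_order all_algebra.
From mathcomp Require Import all_classical all_reals all_analysis.

Set Implicit Arguments.
Unset Strict Implicit.
Unset Printing Implicit Defensive.
Import Order.TTheory GRing.Theory Num.Theory.
Import numFieldNormedType.Exports.

Local Open Scope classical_set_scope.
Local Open Scope ring_scope.

Section defs.
Context {R : realType}.

Definition leb1 : {measure set (measurableTypeR R) -> \bar R} :=
  @lebesgue_measure R.

Definition leb2 :
    {measure set (measurableTypeR R * measurableTypeR R)%type -> \bar R} :=
  (@lebesgue_measure R \x @lebesgue_measure R)%E.

Definition Omega : set (R * R) := [set z | 0 < z.2 < 1].

(** Functions on Omega are represented by total functions on R * R; every notion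
    below depends on their values in Omega only.
    Coordinate [ord0] is x and coordinate [ord_max] is y. *)

(** L^2(Omega), L^2(R), and the L^p(Omega) norms *)

Definition L2 (f : R * R -> R) : Prop := (f \_ Omega) \in Lfun leb2 2%:E.

Definition LpnormO (p : \bar R) (f : R * R -> R) : \bar R :=
  ('N[leb2]_p [EFin \o (f \_ Omega)])%E.

Definition L2R (t : R -> R) : Prop := t \in Lfun leb1 2%:E.

Definition L2normR (t : R -> R) : \bar R := ('N[leb1]_2%:E [EFin \o t])%E.

(** C^infty and test functions *)

Definition unit_vec (i : 'I_2) : R * R :=
  ((i == ord0)%:R, (i == ord_max)%:R).

Definition pderiv (s : seq 'I_2) (f : R * R -> R) : R * R -> R :=
  foldr (fun i g => fun z => 'D_(unit_vec i) g z) f s.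

Definition smooth (f : R * R -> R) : Prop :=
  forall s, continuous (pderiv s f) /\
    forall i z, derivable (pderiv s f) z (unit_vec i).

Definition test_function (U : set (R * R)) (phi : R * R -> R) : Prop :=
  smooth phi /\
  exists K, [/\ compact K, K `<=` U & forall z, ~ K z -> phi z = 0].

(** Weak derivatives; [(a, b) : nat * nat] is the multi-index of
    (d/dx)^a (d/dy)^b. *)

Definition mderiv (a : nat * nat) : (R * R -> R) -> R * R -> R :=
  pderiv (nseq a.1 ord0 ++ nseq a.2 ord_max).

Definition loc_integrable (f : R * R -> R) : Prop :=
  measurable_fun (Omega : set (measurableTypeR R * measurableTypeR R)) f /\
  forall K : set (R * R), compact K -> K `<=` Omega ->
    leb2.-integrable K (EFin \o f).

Definition is_wderiv (a : nat * nat) (f g : R * R -> R) : Prop :=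
  [/\ loc_integrable f, loc_integrable g &
    forall phi, test_function Omega phi ->
      \int[leb2]_(z in Omega) (f z * mderiv a phi z) =
      (-1) ^+ (a.1 + a.2) * \int[leb2]_(z in Omega) (g z * phi z)].

(** "The" weak derivative is a chosen representative, unique up to
    a null subset of Omega (0 if there is none). *)
Definition wderiv (a : nat * nat) (f : R * R -> R) : R * R -> R :=
  xget (fun=> 0) [set g | is_wderiv a f g].

Definition unit_index (i : 'I_2) : nat * nat :=
  (nat_of_bool (i == ord0), nat_of_bool (i == ord_max)).

Definition wpartial (i : 'I_2) : (R * R -> R) -> R * R -> R :=
  wderiv (unit_index i).

(** H^m(Omega) *)

Definition sobolevH (m : nat) (f : R * R -> R) : Prop :=
  L2 f /\
  forall a : nat * nat, (a.1 + a.2 <= m)%N ->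
    exists2 g, is_wderiv a f g & L2 g.

Definition Hnorm (m : nat) (f : R * R -> R) : \bar R :=
  sqrte (\sum_(i < m.+1) \sum_(j < m.+1 | (i + j <= m)%N)
           LpnormO 2%:E (wderiv (nat_of_ord i, nat_of_ord j) f) ^+ 2)%E.

(** Traces on the boundary component R x {b}, b = 0 ([false]) or 1 ([true]):
    the extension to H^1(Omega), by density and continuity, of the restriction
    phi |-> phi(., b) of functions phi in C_c^infty(R^2). *)

Definition is_trace (b : bool) (f : R * R -> R) (t : R -> R) : Prop :=
  [/\ sobolevH 1 f, L2R t &
    exists phi : nat -> R * R -> R,
      [/\ forall n, test_function setT (phi n),
          Hnorm 1 (phi n \- f) @[n --> \oo] --> 0%E &
          L2normR (fun x => phi n (x, b%:R) - t x) @[n --> \oo] --> 0%E]].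

Definition trace (b : bool) (f : R * R -> R) : R -> R :=
  xget (fun=> 0) [set t | is_trace b f t].

(** Vector fields, given by their two components *)

Definition vfield := 'I_2 -> R * R -> R.

Definition divergence (v : vfield) (z : R * R) : R :=
  \sum_i wpartial i (v i) z.

Definition sym_grad (v : vfield) (i j : 'I_2) (z : R * R) : R :=
  2^-1 * (wpartial j (v i) z + wpartial i (v j) z).

Definition normal (b : bool) (i : 'I_2) : R :=
  if i == ord_max then (if b then 1 else -1) else 0.

(** The slip condition below is invariant under tau |-> - tau. *)
Definition tangent (i : 'I_2) : R := (i == ord0)%:R.

Definition slip (k0 k1 : R) (b : bool) : R := if b then k1 else k0.

Definition spaceV (v : vfield) : Prop :=
  [/\ forall i, sobolevH 1 (v i),
      {ae leb2, forall z, Omega z -> divergence v z = 0} &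
      forall b, {ae leb1, forall x,
        \sum_i trace b (v i) x * normal b i = 0}].

Definition spaceW (mu k0 k1 : R) (v : vfield) : Prop :=
  [/\ spaceV v, forall i, sobolevH 2 (v i) &
      forall b, {ae leb1, forall x,
        2 * mu * (\sum_i (\sum_j trace b (sym_grad v i j) x * normal b j)
                    * tangent i)
        = slip k0 k1 b * \sum_i trace b (v i) x * tangent i}].

Definition vL2norm (v : vfield) : \bar R :=
  sqrte (\sum_i LpnormO 2%:E (v i) ^+ 2)%E.

Definition vLinftynorm (v : vfield) : \bar R :=
  LpnormO +oo%E (fun z => Num.sqrt (\sum_i v i z ^+ 2)).

Definition vH2norm (v : vfield) : \bar R :=
  sqrte (\sum_i Hnorm 2 (v i) ^+ 2)%E.

End defs.

Arguments vfield R : clear implicits.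

(* Main.v *)
(** Each component f of u is estimated separately.  Let [ramp] be smooth, equal to 0
    for x <= 0 and to x for x >= 1.  The second derivative of [d * ramp ((x - a) / d)]
    is a bump of width d and integral 1, and the bumps of widths d <= h at the same
    point a differ by s'', where s is supported in the wider interval, |s| <= 2h and
    s' is bounded.  Hence a narrow tensor bump is a bump of width h plus corrections
    whose derivatives can be moved onto f, and its pairing with f is at most
    C (||f|| / h + h ||D^2 f||), independently of the narrow width.  By Fubini and
    the Lebesgue differentiation theorem in each variable, |f| satisfies the same
    bound almost everywhere; take h = (||f|| / ||f||_{H^2})^(1/2) / 3.  Vertically,
    bumps are supported on the side of a that points to the interior of the strip. *)
Require Import Defs.
From mathcomp Require Import all_boot all_order all_algebra ring lra.
From mathcomp Require Import all_classical all_reals all_analysis.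
From mathcomp Require Import measurable_realfun ess_sup_inf.
Import Order.TTheory GRing.Theory Num.Theory.
Import numFieldNormedType.Exports.
Set Implicit Arguments.
Unset Strict Implicit.
Unset Printing Implicit Defensive.
Local Open Scope classical_set_scope.
Local Open Scope ring_scope.

(** * Smooth functions of one variable *)

Section smooth_functions_of_one_variable.
Context {R : realType}.
Implicit Types f g : R -> R.

(** A component f of u is only an L^2 function with weak derivatives, which are tested against
    functions compactly supported in the open strip; its values are reached through pairings with
    such functions. Tensor products reduce smoothness, differentiation and the passage to points to
    one variable at a time. The powers of h come from scaling. On a square of side h, the L^2 norm
    of a function bounded by c is at most c h; a bump has size 1/h, s has size h, and s' has size 1.
    So bump times bump pairs with f at cost 1/h, while s times bump, or s' t', pairs with a second
    derivative of f at cost h. The obstacle is s'' t'': moving all its derivatives would require a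
    fourth derivative of f, so one is moved in each variable. No power of the narrow width remains,
    and it may tend to 0. The square root in h balances ||f|| / h against h ||D^2 f||; the factor
    1/3 leaves room, in a strip of height 1, for a support above or below each point. *)

Fixpoint Cn (n : nat) f : Prop :=
  if n is m.+1 then (forall x : R, derivable f x 1) /\ Cn m (derive1 f) else True.

(** [Cn n] does not ask for continuity of the last derivative; over all n this is automatic, each
    derivative being derivable in turn. *)
Definition smooth1 f := forall n, Cn n f.

Lemma CnS n f : Cn n.+1 f -> Cn n f.
Proof.
elim: n f => [//|n IH] f [df Cf]; split => //; exact: IH.
Qed.

Lemma CnI n f f' : (forall x : R, is_derive x 1 f (f' x)) -> Cn n f' -> Cn n.+1 f.
Proof.
move=> df Cf'; split; first by move=> x; have [] := df x.
by rewrite (_ : (derive1 f) = f')//; apply/funext => x; rewrite derive1E derive_val.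
Qed.

Lemma CnE n f : Cn n.+1 f -> forall x : R, is_derive x 1 f ((derive1 f) x).
Proof. by case=> df _ x; rewrite derive1E; apply: derivableP. Qed.

Lemma Cn_cst n (c : R) : Cn n (cst c).
Proof.
elim: n c => [//|n IH] c; apply: (@CnI _ _ (cst 0)); last exact: IH.
Qed.

Lemma Cn_id n : Cn n (id : R -> R).
Proof.
case: n => [//|n]; apply: (@CnI _ _ (cst 1)); last exact: Cn_cst.
Qed.

Lemma CnD n f g : Cn n f -> Cn n g -> Cn n (f + g).
Proof.
elim: n f g => [//|n IH] f g Cf Cg.
apply: (@CnI _ _ ((derive1 f) + (derive1 g))); last by apply: IH; [case: Cf|case: Cg].
by move=> x; apply: is_deriveD; [exact: CnE Cf x|exact: CnE Cg x].
Qed.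

Lemma CnM n f g : Cn n f -> Cn n g -> Cn n (f * g).
Proof.
elim: n f g => [//|n IH] f g Cf Cg.
apply: (@CnI _ _ (f * (derive1 g) + g * (derive1 f))).
  move=> x; have := CnE Cf x; have := CnE Cg x => dg df.
  exact: is_deriveM.
have [_ Cf'] := Cf; have [_ Cg'] := Cg.
by apply: CnD; apply: IH => //; exact: CnS.
Qed.

Lemma CnN n f : Cn n f -> Cn n (- f).
Proof.
move=> Cf; rewrite (_ : - f = cst (-1) * f); first by apply: CnM => //; exact: Cn_cst.
by apply/funext => x; rewrite !fctE mulN1r.
Qed.

(** The derivative - f' / f^2 is a product involving 1/f itself, so the induction runs on n with f
    fixed. *)
Lemma CnV n f : (forall x, f x != 0) -> Cn n f -> Cn n (fun x => (f x)^-1).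
Proof.
move=> f0; elim: n => [//|n IH] Cf.
have CV := IH (CnS Cf).
apply: (@CnI _ _ (- ((fun x => (f x)^-1) * (fun x => (f x)^-1) * (derive1 f)))).
  move=> x; have df := CnE Cf x.
  apply: (is_derive_eq (is_deriveV (f0 x) df)).
  by rewrite !fctE /GRing.scale /= expr2 invfM mulNr.
by apply: CnN; apply: CnM; [exact: CnM|case: Cf].
Qed.

Lemma is_derive_affine f (a b x df : R) : is_derive (a * (x - b)) 1 f df ->
  is_derive x 1 (fun x => f (a * (x - b))) (a * df).
Proof.
move=> Df.
have -> : (fun x => f (a * (x - b))) = f \o (fun x => a * (x - b)) by [].
have Da : is_derive x 1 (fun x : R => a * (x - b)) a.
  apply: is_derive_eq; rewrite /= /GRing.scale /=.
  by rewrite !(scaler0, scale0r, mulr0, mul0r, addr0, add0r, subr0, mulr1).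
rewrite mulrC; exact: is_derive1_comp.
Qed.

Lemma Cn_affine n f (a b : R) : Cn n f -> Cn n (fun x => f (a * (x - b))).
Proof.
elim: n f => [//|n IH] f Cf.
apply: (@CnI _ _ (cst a * (fun x => (derive1 f) (a * (x - b))))).
  by move=> x; apply: is_derive_affine; exact: CnE Cf _.
by apply: CnM; [exact: Cn_cst|apply: IH; case: Cf].
Qed.

Lemma smooth1_derivable f (x : R) : smooth1 f -> derivable f x 1.
Proof. by move=> /(_ 1%N) [+ _]; apply. Qed.

Lemma smooth1_is_derive f (x : R) : smooth1 f -> is_derive x 1 f ((derive1 f) x).
Proof. by move=> sf; rewrite derive1E; apply/derivableP/smooth1_derivable. Qed.

Lemma smooth1_derive1 f : smooth1 f -> smooth1 (derive1 f).
Proof. by move=> sf n; case: (sf n.+1). Qed.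

Lemma smooth1_continuous f : smooth1 f -> continuous f.
Proof.
by move=> sf x; apply/differentiable_continuous/derivable1_diffP/smooth1_derivable.
Qed.

End smooth_functions_of_one_variable.

(** * A smooth step and a smooth ramp *)

Section smooth_step.
Context {R : realType}.

(* At 0, the difference quotient of [flat k] is [flat k.+1], which tends to 0
   because exp (1/x) dominates every power of 1/x. *)
Definition flat (k : nat) (x : R) : R :=
  if 0 < x then (x ^- k) * expR (- x^-1) else 0.

Lemma flat_ge0 k x : 0 <= flat k x.
Proof.
rewrite /flat; case: ifP => // x0.
by rewrite mulr_ge0 ?expR_ge0// invr_ge0 exprn_ge0// ltW.
Qed.

(** Of the series of exp (1/x), only the term of order k+1 is kept. *)
Lemma flat_le k x : 0 <= x -> flat k x <= (k.+1)`!%:R * x.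
Proof.
move=> x0; rewrite /flat; case: ifPn => [xp|_]; last first.
  by rewrite mulr_ge0.
have xi : 0 <= x^-1 by rewrite invr_ge0.
have := expR_ge1Dxn k xi.
rewrite expRN => h.
have {}h : x^-1 ^+ k.+1 / (k.+1)`!%:R <= expR x^-1 by apply: le_trans h; rewrite lerDr.
rewrite -exprVn ler_pdivrMr ?expR_gt0//.
have f0 : 0 < (k.+1)`!%:R :> R by rewrite ltr0n fact_gt0.
apply: (@le_trans _ _ ((k.+1)`!%:R * x * (x^-1 ^+ k.+1 / (k.+1)`!%:R))); last first.
  by rewrite ler_pM2l// mulr_gt0.
rewrite exprS le_eqVlt; apply/orP; left; apply/eqP.
by field; rewrite !gt_eqF.
Qed.

Lemma is_derive_flat k (x : R) :
  is_derive x 1 (flat k) (flat k.+2 x - k%:R * flat k.+1 x).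
Proof.
have [x0|x0|->] := ltgtP x 0.
- have -> : flat k.+2 x - k%:R * flat k.+1 x = 0.
    by rewrite /flat !(ltNge _ x) (ltW x0) /= mulr0 subr0.
  apply: (@near_eq_is_derive _ _ _ (cst 0)).
    near=> y; rewrite /flat ifF//; apply/negbTE; rewrite -leNgt ltW//.
    near: y; exact: lt_nbhsl.
- have xn0 : x != 0 by rewrite gt_eqF.
  have dV : is_derive x 1 (fun y : R => y^-1) (- x ^- 2).
    by apply: (is_derive_eq (is_deriveV xn0 (is_derive_id x 1))); rewrite /GRing.scale /= mulr1.
  have dE : is_derive x 1 (fun y : R => expR (- y^-1)) (expR (- x^-1) * x ^- 2).
    rewrite -[x ^- 2]opprK.
    have dN : is_derive x 1 (fun y : R => - y^-1) (- - x ^- 2) by apply: is_deriveN.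
    exact: (@is_derive1_comp _ expR (fun y => - y^-1)).
  have dX := @is_deriveX _ _ _ k _ _ _ dV.
  have D : is_derive x 1 ((fun y : R => y^-1) ^+ k * (fun y : R => expR (- y^-1)))
      (flat k.+2 x - k%:R * flat k.+1 x).
    apply: (is_derive_eq (is_deriveM dX dE)).
    rewrite /flat x0 /GRing.scale /= !fctE -!exprVn.
    case: k {dX} => [|k] /=; first by rewrite !mul0r mulr0 subr0 addr0 expr0 mul1r mulrC.
    by rewrite !exprS; ring.
  apply: near_eq_is_derive D; near=> y.
  rewrite /flat ifT ?fctE ?exprVn//.
  near: y; exact: lt_nbhsr.
- have -> : flat k.+2 0 - k%:R * flat k.+1 0 = 0 by rewrite /flat ltxx mulr0 subr0.
  have h : (fun h => h^-1 *: (flat k (h *: 1 + 0) - flat k 0)) @ 0^' --> (0 : R).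
    apply/cvgrPdist_le => e e0.
    have d0 : 0 < e / (k.+2)`!%:R by rewrite divr_gt0// ltr0n fact_gt0.
    have nb : \forall h \near (0:R)^', `|h| < e / (k.+2)`!%:R.
      by apply: dnbhs0_lt.
    near=> h.
    have hd : `|h| < e / (k.+2)`!%:R by near: h.
    rewrite sub0r normrN addr0 {2}/flat ltxx subr0 /GRing.scale /= mulr1.
    have [h0|h0] := ltP 0 h; last by rewrite /flat ltNge h0 mulr0 normr0 ltW.
    have -> : h^-1 * flat k h = flat k.+1 h.
      by rewrite /flat h0 exprS invfM mulrA.
    rewrite ger0_norm ?flat_ge0//.
    rewrite (le_trans (flat_le _ (ltW h0)))// mulrC.
    move: hd; rewrite gtr0_norm// ltr_pdivlMr ?ltr0n ?fact_gt0//.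
    exact: ltW.
  split; first by apply/cvg_ex; exists 0.
  by apply/cvg_lim.
Unshelve. all: by end_near. Qed.

(** The derivative of [flat k] is a combination with constant coefficients of [flat k.+1] and
    [flat k.+2], so the induction on n must cover all k at once. *)
Lemma smooth1_flat k : smooth1 (flat k).
Proof.
move=> n; elim: n k => [//|n IH] k.
apply: (@CnI _ _ _ (flat k.+2 - cst k%:R * flat k.+1)).
  by move=> x; apply: is_derive_flat.
by apply: CnD => //; apply: CnN; apply: CnM => //; exact: Cn_cst.
Qed.

Definition step (x : R) : R := flat 0 x / (flat 0 x + flat 0 (1 - x)).

Lemma step_den_gt0 x : 0 < flat 0 x + flat 0 (1 - x).
Proof.
have [x0|x0] := ltP 0 x.
  rewrite ltr_wpDr ?flat_ge0//.
  by rewrite /flat x0 expr0 invr1 mul1r expR_gt0.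
rewrite ltr_wpDl ?flat_ge0// /flat ifT ?expr0 ?invr1 ?mul1r ?expR_gt0//.
by rewrite subr_gt0 (le_lt_trans x0).
Qed.

Lemma step0 x : x <= 0 -> step x = 0.
Proof. by move=> x0; rewrite /step /flat ltNge x0 mul0r. Qed.

Lemma step1 x : 1 <= x -> step x = 1.
Proof.
move=> x1; have := step_den_gt0 x; rewrite /step.
have -> : flat 0 (1 - x) = 0 by rewrite /flat subr_gt0 ltNge x1.
by rewrite addr0 => h; rewrite divff// gt_eqF.
Qed.

Lemma step_ge0 x : 0 <= step x.
Proof. by rewrite divr_ge0 ?flat_ge0// ltW// step_den_gt0. Qed.

Lemma step_le1 x : step x <= 1.
Proof. by rewrite ler_pdivrMr ?step_den_gt0// mul1r lerDl flat_ge0. Qed.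

Lemma smooth1_step : smooth1 step.
Proof.
move=> n; apply: CnM; first exact: smooth1_flat.
apply: CnV; first by move=> x; rewrite gt_eqF// step_den_gt0.
apply: CnD; first exact: smooth1_flat.
rewrite (_ : (fun x => _) = (fun x => flat 0 (-1 * (x - 1)))); last first.
  by apply/funext => x; rewrite mulN1r opprB.
exact/Cn_affine/smooth1_flat.
Qed.

(** Being exactly x, with no additive constant, beyond 1 makes d * [ramp] (x / d) independent of d
    beyond d, so that differences of two widths have compact support. The price is that the slope, 0
    at the origin and of mean 1 on [0, 1], overshoots 1: the bump changes sign, and later arguments
    rely on its absolute value, not on positivity. *)
Definition ramp (x : R) : R := x * step x.

Lemma smooth1_ramp : smooth1 ramp.
Proof. by move=> n; apply: CnM; [exact: Cn_id|exact: smooth1_step]. Qed.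

Lemma ramp0 x : x <= 0 -> ramp x = 0.
Proof. by move=> x0; rewrite /ramp step0// mulr0. Qed.

Lemma ramp1 x : 1 <= x -> ramp x = x.
Proof. by move=> x0; rewrite /ramp step1// mulr1. Qed.

Lemma ramp_norm x : `|ramp x| <= `|x|.
Proof. by rewrite normrM ler_piMr// ger0_norm ?step_ge0 ?step_le1. Qed.

End smooth_step.

(** * Almost-everywhere bounds from pairings with bumps *)

Section integrability.
Context d (T : measurableType d) (R : realType) (mu : {measure set T -> \bar R}).
Implicit Types (f g : T -> R).

Lemma integrable_mul_bounded f g (c : R) :
  mu.-integrable setT (EFin \o f) -> measurable_fun setT g ->
  (forall x, `|g x| <= c) ->
  mu.-integrable setT (EFin \o (fun x => f x * g x)).
Proof.
move=> intf mg gc.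
have mf : measurable_fun setT f by apply/measurable_EFinP; exact: measurable_int intf.
have /(le_integrable measurableT) : mu.-integrable setT (fun x => (c%:E * (f x)%:E)%E).
  exact: integrableZl.
apply; first by apply/measurable_EFinP/measurable_funM.
move=> x _ /=; rewrite lee_fin !normrM mulrC ler_wpM2r//.
by rewrite (le_trans (gc x))// ler_norm.
Qed.

Lemma integrable_bounded_support (A : set T) g (c : R) :
  measurable A -> (mu A < +oo)%E -> measurable_fun setT g ->
  (forall x, `|g x| <= c) -> (forall x, ~ A x -> g x = 0) ->
  mu.-integrable setT (EFin \o g).
Proof.
move=> mA Aoo mg gc gA.
have -> : EFin \o g = (EFin \o g) \_ A.
  apply/funext => x; rewrite patchE; case: ifPn => //.
  by rewrite notin_setE => /gA /= ->.
apply/(integrable_mkcond _ mA).1; apply: measurable_bounded_integrable => //.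
  exact: measurable_funS mg.
by exists c; split; [exact: num_real|move=> y cy x _; apply: le_trans (ltW cy); exact: gc].
Qed.

Lemma RintegralD4 (f1 f2 f3 f4 : T -> R) :
  mu.-integrable setT (EFin \o f1) -> mu.-integrable setT (EFin \o f2) ->
  mu.-integrable setT (EFin \o f3) -> mu.-integrable setT (EFin \o f4) ->
  \int[mu]_x (f1 x + f2 x + (f3 x + f4 x)) =
  \int[mu]_x f1 x + \int[mu]_x f2 x + (\int[mu]_x f3 x + \int[mu]_x f4 x).
Proof.
move=> i1 i2 i3 i4.
have i12 : mu.-integrable setT (EFin \o (fun x => f1 x + f2 x)).
  exact: (integrableD measurableT i1 i2).
have i34 : mu.-integrable setT (EFin \o (fun x => f3 x + f4 x)).
  exact: (integrableD measurableT i3 i4).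
by rewrite !RintegralD.
Qed.

End integrability.

Section almost_everywhere.
Context d (T : measurableType d) (R : realType) (mu : {measure set T -> \bar R}).
Implicit Types P Q : T -> Prop.

Lemma ae_mono P Q : {ae mu, forall x, P x} -> (forall x, P x -> Q x) ->
  {ae mu, forall x, Q x}.
Proof. by move=> aeP PQ; apply: filterS aeP. Qed.

Lemma ae_conj P Q : {ae mu, forall x, P x} -> {ae mu, forall x, Q x} ->
  {ae mu, forall x, P x /\ Q x}.
Proof. by move=> aeP aeQ; apply: filterS2 aeP aeQ => x. Qed.

End almost_everywhere.

(** * Pointwise bounds on the line, at Lebesgue points *)

Section lebesgue_points.
Context {R : realType}.
Local Notation mu := (@lebesgue_measure R).
Implicit Types (G : R -> R) (psi : nat -> R -> R).

(** As |[psi n]| has height at most C (n+1) and lives in the ball of radius r = 2/(n+1) around x,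
    replacing G by the constant G x in the pairing costs at most 4 C times the mean of |G - G x|
    over that ball, which tends to 0. Only the absolute value of the integral is prescribed, because
    bumps pointing to the left have integral -1. *)
Lemma lebesgue_pt_approx_le G x (psi : nat -> R -> R) (C M : R) N :
  mu.-integrable setT (EFin \o G) -> lebesgue_pt G x ->
  (forall n, measurable_fun setT (psi n)) ->
  (forall n y, `|psi n y| <= C * n.+1%:R) ->
  (forall n y, 2 / n.+1%:R <= `|x - y| -> psi n y = 0) ->
  (forall n, `|\int[mu]_y psi n y| = 1) ->
  (forall n, (N <= n)%N -> `|\int[mu]_y (G y * psi n y)| <= M) ->
  `|G x| <= M.
Proof.
move=> iG /fine_cvgP[dfin dcvg] mpsi psib psi0 psi1 GM.
have C0 : 0 <= C.
  by rewrite -(pmulr_lge0 C (ltr0Sn R 0)); apply: le_trans (psib 0%N x).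
have mG : measurable_fun setT G by apply/measurable_EFinP; exact: measurable_int iG.
have muB r : 0 <= r -> mu (ball x r) = (r *+ 2)%:E by exact: lebesgue_measure_ball.
have ipsi n : mu.-integrable setT (EFin \o psi n).
  have muoo : (mu (ball x (2 / n.+1%:R)) < +oo)%E by rewrite muB// ltry.
  have mB : measurable (ball x (2 / n.+1%:R) : set (measurableTypeR R)).
    exact: measurable_ball.
  apply: (integrable_bounded_support mB muoo (mpsi n) (psib n)).
  by move=> y; rewrite /ball /= => /negP; rewrite -leNgt; exact: psi0.
have iGpsi n : mu.-integrable setT (EFin \o (fun y => G y * psi n y)).
  exact: (integrable_mul_bounded iG (mpsi n) (psib n)).
apply/ler_addgt0Pr => e e0.
(* 4 C is the height C (n+1) times the length 4/(n+1) of the ball; the added 1 avoids a division by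
   0. *)
have d0 : 0 < e / (4 * C + 1) by rewrite divr_gt0// ltr_wpDl// mulr_ge0.
move/cvgrPdist_lt : dcvg => /(_ _ d0) [d1 /= d1_gt0 dlt].
move: dfin => [d2 /= d2_gt0 dfin].
have [n [Nn nd1 nd2]] : exists n : nat, [/\ (N <= n)%N, 2 / n.+1%:R < d1 & 2 / n.+1%:R < d2].
  exists (N + (Num.truncn (2 / d1) + Num.truncn (2 / d2)))%N; split; first exact: leq_addr.
    rewrite ltr_pdivrMr// mulrC -ltr_pdivrMr// (lt_le_trans (truncnS_gt _))//.
    by rewrite ler_nat ltnS addnCA leq_addr.
  rewrite ltr_pdivrMr// mulrC -ltr_pdivrMr// (lt_le_trans (truncnS_gt _))//.
  by rewrite ler_nat ltnS addnA leq_addl.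
set r : R := 2 / n.+1%:R in nd1 nd2.
have r0 : 0 < r by rewrite divr_gt0.
have dr : ball (0 : R) d1 r by rewrite /ball /= sub0r normrN gtr0_norm.
have dr2 : ball (0 : R) d2 r by rewrite /ball /= sub0r normrN gtr0_norm.
have {}dlt := dlt r dr r0.
have {}dfin := dfin r dr2 r0.
have mB : measurable (ball x r : set (measurableTypeR R)) by exact: measurable_ball.
have muBr : mu (ball x r) = (r *+ 2)%:E by apply: muB; exact: ltW.
pose H y := `|G y - G x|.
have iD : mu.-integrable (ball x r) (EFin \o (fun y => G y - G x)).
  have i1 : mu.-integrable (ball x r) (EFin \o G) by apply: integrableS iG.
  have i2 : mu.-integrable (ball x r) (EFin \o cst (G x)).
    have muBoo : (mu (ball x r) < +oo)%E by rewrite muBr ltry.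
    by apply: measurable_bounded_integrable => //; exact: bounded_cst.
  exact: (integrableB mB i1 i2).
have iH : mu.-integrable (ball x r) (EFin \o H) by exact: (integrable_abse iD).
have dE : \int[mu]_(y in ball x r) H y = (4 / n.+1%:R) * fine (davg G x r).
  have r2n0 : r *+ 2 != 0 by rewrite mulrn_eq0 /= gt_eqF.
  rewrite /davg /iavg muBr inver (negbTE r2n0) fineM//; last first.
    have := integrable_fin_num mB iH; exact.
  rewrite mulrA (_ : 4 / n.+1%:R * _ = 1) ?mul1r//.
  rewrite /= /r; field.
  by rewrite nat1r !pnatr_eq0.
have GxE : `|G x| = `|\int[mu]_y (G x * psi n y)|.
  by rewrite RintegralZl// normrM psi1 mulr1.
rewrite GxE.
have iGx : mu.-integrable setT (EFin \o (fun y => G x * psi n y)).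
  exact: (integrableZl measurableT (G x) (ipsi n)).
have DE : \int[mu]_y ((G y - G x) * psi n y) =
    \int[mu]_y (G y * psi n y) - \int[mu]_y (G x * psi n y).
  by rewrite -RintegralB//; apply: eq_Rintegral => y _; rewrite mulrBl.
have iDpsi : mu.-integrable setT (EFin \o (fun y => (G y - G x) * psi n y)).
  have -> : (fun y => (G y - G x) * psi n y) =
            (fun y => G y * psi n y - G x * psi n y).
    by apply/funext => y; rewrite mulrBl.
  exact: (integrableB measurableT (iGpsi n) iGx).
have -> : \int[mu]_y (G x * psi n y) =
    \int[mu]_y (G y * psi n y) - \int[mu]_y ((G y - G x) * psi n y).
  by rewrite DE opprB addrCA subrr addr0.
rewrite (le_trans (ler_normB _ _))// lerD ?GM//.
have : `|\int[mu]_y ((G y - G x) * psi n y)| <=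
    C * n.+1%:R * \int[mu]_(y in ball x r) H y.
  rewrite (le_trans (le_normr_Rintegral measurableT iDpsi))//.
  rewrite -RintegralZl// [leRHS]Rintegral_mkcond.
  apply: le_Rintegral => //.
  - exact: (integrable_abse iDpsi).
  - rewrite -restrict_EFin; apply/(integrable_mkcond _ mB).1.
    exact: (integrableZl mB (C * n.+1%:R) iH).
  - move=> y _; rewrite patchE normrM /H; case: ifPn => yB.
      by rewrite mulrC ler_wpM2r.
    rewrite psi0 ?normr0 ?mulr0// leNgt.
    by apply/negP; move: yB; rewrite notin_setE.
move/le_trans; apply; rewrite dE.
rewrite mulrA (_ : C * n.+1%:R * _ = 4 * C); last first.
  by field; rewrite nat1r pnatr_eq0.
move: dlt; rewrite sub0r normrN => dlt.
have := le_lt_trans (ler_norm _) dlt.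
rewrite ltr_pdivlMr; last by rewrite ltr_wpDl// mulr_ge0.
move=> h; rewrite (le_trans _ (ltW h))// mulrC ler_wpM2l ?lerDl//.
by rewrite fine_ge0// davg_ge0.
Qed.

(** Bounds are assumed at rational centres only, so that in the plane countably many exceptional
    null sets suffice. *)
Lemma ae_le_approx (psi : R -> nat -> R -> R) G (a b C M : R) N :
  mu.-integrable setT (EFin \o G) ->
  (forall q n, measurable_fun setT (psi q n)) ->
  (forall q n y, `|psi q n y| <= C * n.+1%:R) ->
  (forall q n y, n.+1%:R^-1 < `|q - y| -> psi q n y = 0) ->
  (forall q n, `|\int[mu]_y psi q n y| = 1) ->
  (forall (q : rat) n, a < ratr q < b -> (N <= n)%N ->
     `|\int[mu]_y (G y * psi (ratr q) n y)| <= M) ->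
  {ae mu, forall x, a < x < b -> `|G x| <= M}.
Proof.
move=> iG mpsi psib psi0 psi1 GM.
apply: (ae_mono (lebesgue_differentiation (open_integrable_locally openT iG))) => x Gx /andP[ax xb].
(* The n-th bump is centred within 1/(n+1) of x and supported within 1/(n+1) of its centre, whence
   the radius 2/(n+1) around x. *)
have qx n : exists q : rat, x < ratr q < Num.min b (x + n.+1%:R^-1).
  have /rat_in_itvoo[q] : x < Num.min b (x + n.+1%:R^-1).
    by rewrite lt_min xb ltrDl invr_gt0 ltr0Sn.
  by rewrite in_itv /=; exists q.
pose q n : R := ratr (sval (cid (qx n))).
have qP n : x < q n < Num.min b (x + n.+1%:R^-1) by rewrite /q; case: cid.
apply: (@lebesgue_pt_approx_le G x (fun n => psi (q n) n) C M N) => //.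
- move=> n y xy; apply: psi0.
  have /andP[xq] := qP n; rewrite lt_min => /andP[_ qn].
  have : `|x - q n| < n.+1%:R^-1.
    by rewrite distrC gtr0_norm ?subr_gt0// ltrBlDl.
  have := ler_distD (q n) x y.
  move: xy; have -> : 2 / n.+1%:R = n.+1%:R^-1 + n.+1%:R^-1 :> R by rewrite mulr_natl mulr2n.
  by move: (n.+1%:R^-1) => e h1 h2 h3; lra.
- move=> n Nn; apply: GM => //.
  have /andP[xq] := qP n; rewrite lt_min => /andP[qb _].
  by rewrite (lt_trans ax xq).
Qed.

End lebesgue_points.

(** * From the line to the plane, by Fubini *)

Section ae_bound_in_the_plane.
Context {R : realType}.
Local Notation mu := (@lebesgue_measure R).

Lemma ae_leb2 (A : set (R * R)) :
  measurable (A : set (measurableTypeR R * measurableTypeR R)%type) ->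
  {ae mu, forall x, mu (xsection A x) = 0%E} ->
  leb2 A = 0%E.
Proof.
move=> mA A0; rewrite /leb2 /= /product_measure1.
transitivity (\int[mu]_x (cst 0%E x : \bar R))%E; last by rewrite integral0.
apply: ae_eq_integral => //.
  exact: measurable_fun_xsection.
by apply: (ae_mono A0) => x Ax _.
Qed.

Lemma integrable_fine (h : R -> \bar R) : mu.-integrable setT h ->
  mu.-integrable setT (EFin \o (fine \o h)).
Proof.
move=> ih; have mh := measurable_int _ ih.
apply: le_integrable ih => //.
  by apply/measurable_EFinP; apply: measurableT_comp.
by move=> x _ /=; case: (h x) => //= *; rewrite ?normr0 ?leey.
Qed.

Lemma Rintegral_fubini (F : R * R -> R) (f : R -> R) c :
  leb2.-integrable setT (EFin \o F) -> measurable_fun setT f ->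
  (forall x, `|f x| <= c) ->
  \int[mu]_x ((\int[mu]_y F (x, y)) * f x) = \int[leb2]_z (F z * f z.1).
Proof.
move=> iF mf fc.
have mf1 : measurable_fun setT (fun z : measurableTypeR R * measurableTypeR R => f z.1).
  exact: measurableT_comp.
have iFf : leb2.-integrable setT (EFin \o (fun z => F z * f z.1)).
  by apply: (integrable_mul_bounded iF mf1 (c := c)).
rewrite /Rintegral; congr fine.
rewrite -(integral12_prod_meas1 iFf).
apply: ae_eq_integral => //.
- apply/measurable_EFinP; apply: measurable_funM => //.
  apply/measurable_EFinP; exact: measurable_int (integrable_fine (integrable_fubini_F iF)).
- exact: measurable_int (integrable_fubini_F iFf).
(* The factor f x enters the inner integral only where the section of F is integrable, which holds
   for almost every x. *)
- apply: (ae_mono (ae_integrable1 iF)) => x ix _ /=.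
  rewrite /fubini_F /= -/(Rintegral _ _ _) -RintegralZr//.
  rewrite /Rintegral fineK//.
  apply: (integrable_fin_num measurableT).
  exact: (integrableZr measurableT (f x) ix).
Qed.

Section bumps.
Variables (phi psi : R -> nat -> R -> R) (C : R).
Hypothesis mphi : forall q n, measurable_fun setT (phi q n).
Hypothesis phib : forall q n y, `|phi q n y| <= C * n.+1%:R.
Hypothesis phi0 : forall q n y, n.+1%:R^-1 < `|q - y| -> phi q n y = 0.
Hypothesis phi1 : forall q n, `|\int[mu]_y phi q n y| = 1.
Hypothesis mpsi : forall q n, measurable_fun setT (psi q n).
Hypothesis psib : forall q n y, `|psi q n y| <= C * n.+1%:R.
Hypothesis psi0 : forall q n y, n.+1%:R^-1 < `|q - y| -> psi q n y = 0.
Hypothesis psi1 : forall q n, `|\int[mu]_y psi q n y| = 1.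

(** With the bump in y fixed, the one-dimensional result in x bounds the partial pairing for almost
    every x; for such an x, the same result in y applies to F (x, .). *)
Lemma ae_le_approx2 (F : R * R -> R) (a1 b1 a2 b2 M : R) N :
  leb2.-integrable setT (EFin \o F) ->
  (forall (q1 q2 : rat) n1 n2, a1 < ratr q1 < b1 -> a2 < ratr q2 < b2 ->
     (N <= n1)%N -> (N <= n2)%N ->
    `|\int[leb2]_z (F z * (phi (ratr q1) n1 z.1 * psi (ratr q2) n2 z.2))| <= M) ->
  {ae leb2, forall z, a1 < z.1 < b1 -> a2 < z.2 < b2 -> `|F z| <= M}.
Proof.
move=> iF FM.
have mF : measurable_fun (setT : set (measurableTypeR R * measurableTypeR R)%type) F.
  by apply/measurable_EFinP; exact: measurable_int iF.
(* The set where the bound fails is measurable, hence null as soon as almost all its sections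
   are. *)
pose A := [set z : measurableTypeR R * measurableTypeR R |
  [/\ a1 < z.1 < b1, a2 < z.2 < b2 & M < `|F z|]].
have mA : measurable A.
  rewrite (_ : A = ((`]a1, b1[ `*` `]a2, b2[) `&` (setT `&` (fun z => `|F z|) @^-1` `]M, +oo[))); last first.
    apply/seteqP; split=> z /=; rewrite !in_itv /= !andbT.
      by move=> [? ? ?].
    by move=> [[? ?] [_ ?]].
  apply: measurableI; first exact: measurableX.
  by apply: (measurableT_comp _ mF) => //; exact: measurable_normr.
exists A; split => //; last first.
  move=> z /= /not_implyP[z1 /not_implyP[z2 /negP]]; rewrite -ltNge => z3.
  by split.
apply: ae_leb2 => //.
have Fpsi q n : leb2.-integrable setT (EFin \o (fun z => F z * psi q n z.2)).
  apply: (integrable_mul_bounded iF (c := C * n.+1%:R)) => //.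
  exact: measurableT_comp.
have H1 q2 n2 : a2 < ratr q2 < b2 -> (N <= n2)%N ->
  {ae mu, forall x, a1 < x < b1 -> `|\int[mu]_y (F (x, y) * psi (ratr q2) n2 y)| <= M}.
  move=> q2ab Nn2.
  apply: (ae_le_approx (psi := phi) (N := N) _ mphi phib phi0 phi1).
    exact: (integrable_fine (integrable_fubini_F (Fpsi (ratr q2) n2))).
  move=> q1 n1 q1ab Nn1.
  have := Rintegral_fubini (Fpsi (ratr q2) n2) (mphi (ratr q1) n1) (phib _ n1).
  move=> /= ->.
  have := FM q1 q2 n1 n2 q1ab q2ab Nn1 Nn2.
  congr (`| _ | <= _); apply: eq_Rintegral => z _.
  by rewrite mulrAC mulrA.
(* The null set in x depends on the centre and the width of the bump in y; these pairs are
   enumerated to obtain a single null set. *)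
have H2 : {ae mu, forall x, forall k, if unpickle k is Some (q2, n2) then
   a2 < ratr q2 < b2 -> (N <= n2)%N ->
   a1 < x < b1 -> `|\int[mu]_y (F (x, y) * psi (ratr q2) n2 y)| <= M else True}.
  apply/ae_foralln => k; case: unpickle => [[q2 n2]|]; last exact: aeW.
  have [q2ab|] := boolP (a2 < ratr q2 < b2); last by move=> _; exact: aeW.
  have [Nn|] := boolP (N <= n2)%N; last by move=> _; exact: aeW.
  by apply: (ae_mono (H1 _ _ q2ab Nn)) => x Hx _ _.
have H3 := ae_integrable1 iF.
apply: (ae_mono (ae_conj H2 H3)) => x [Hx ix].
have [xab|xab] := boolP (a1 < x < b1); last first.
  rewrite (_ : xsection A x = set0) ?measure0//.
  by apply/seteqP; split => // y; rewrite /xsection /= inE => -[/= x1]; rewrite x1 in xab.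
have := ae_le_approx (psi := psi) (N := N) (M := M) (a := a2) (b := b2) ix mpsi psib psi0 psi1.
have h : forall (q : rat) n, a2 < ratr q < b2 -> (N <= n)%N ->
     `|\int[mu]_y (F (x, y) * psi (ratr q) n y)| <= M.
  move=> q n qab Nn; have := Hx (pickle (q, n)).
  by rewrite pickleK; apply.
move=> /(_ h) [B [mB B0 sB]].
apply: (subset_measure0 _ mB) => //; first exact: measurable_xsection.
move=> y; rewrite /xsection /= inE => -[/= _ y2 My]; apply: sB => /= /(_ y2).
by rewrite leNgt My.
Qed.

End bumps.
End ae_bound_in_the_plane.

(** * Bumps, correctors and their tensor products *)

Section tensor_products.
Context {R : realType}.
Implicit Types (f g : R -> R) (z : R * R).

Definition tens f g : R * R -> R := fun z => f z.1 * g z.2.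

Lemma derive1_cvg f (x : R) : derivable f x 1 ->
  (fun h : R => h^-1 * (f (h + x) - f x)) @ (0 : R)^' --> derive1 f x.
Proof.
move=> df; rewrite derive1E.
have -> : (fun h : R => h^-1 * (f (h + x) - f x)) =
    (fun h : R => h^-1 *: ((f \o shift x) (h *: 1) - f x)).
  by apply/funext => h; rewrite /GRing.scale /= mulr1.
exact: df.
Qed.

Lemma is_derive_tens0 f g z : derivable f z.1 1 ->
  is_derive z (unit_vec ord0) (tens f g) (tens (derive1 f) g z).
Proof.
move=> df.
have h : (fun h : R => h^-1 *: (tens f g (h *: unit_vec ord0 + z) - tens f g z)) @
    (0 : R)^' --> tens (derive1 f) g z.
  rewrite (_ : (fun h : R => _) = (fun h : R => (h^-1 * (f (h + z.1) - f z.1)) * g z.2)).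
    by apply: cvgMl; exact: derive1_cvg.
  apply/funext => h; rewrite /tens /unit_vec /= /GRing.scale /= mulr1 mulr0 add0r.
  by rewrite -mulrA mulrBl.
by split; [apply/cvg_ex; exists (tens (derive1 f) g z)|apply/cvg_lim].
Qed.

Lemma is_derive_tens1 f g z : derivable g z.2 1 ->
  is_derive z (unit_vec ord_max) (tens f g) (tens f (derive1 g) z).
Proof.
move=> df.
have h : (fun h : R => h^-1 *: (tens f g (h *: unit_vec ord_max + z) - tens f g z)) @
    (0 : R)^' --> tens f (derive1 g) z.
  rewrite (_ : (fun h : R => _) = (fun h : R => f z.1 * (h^-1 * (g (h + z.2) - g z.2)))).
    by apply: cvgMr; exact: derive1_cvg.
  apply/funext => h; rewrite /tens /unit_vec /= /GRing.scale /= mulr1 mulr0 add0r.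
  by rewrite [RHS]mulrCA -mulrBr.
by split; [apply/cvg_ex; exists (tens f (derive1 g) z)|apply/cvg_lim].
Qed.

Lemma pderiv0_tens f g : smooth1 f ->
  (fun z => 'D_(unit_vec ord0) (tens f g) z) = tens (derive1 f) g.
Proof.
move=> sf; apply/funext => z.
by have [_ ->] := is_derive_tens0 g (smooth1_derivable (x := z.1) sf).
Qed.

Lemma pderiv1_tens f g : smooth1 g ->
  (fun z => 'D_(unit_vec ord_max) (tens f g) z) = tens f (derive1 g).
Proof.
move=> sg; apply/funext => z.
by have [_ ->] := is_derive_tens1 f (smooth1_derivable (x := z.2) sg).
Qed.

Lemma ord2P (i : 'I_2) : i = ord0 \/ i = ord_max.
Proof. by case: i => [[|[|//]] ?]; [left|right]; apply/val_inj. Qed.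

(** Tensor products of smooth functions are stable under partial derivatives; which factors appear
    is irrelevant to smoothness. *)
Lemma pderiv_tens s f g : smooth1 f -> smooth1 g ->
  exists f' g', [/\ smooth1 f', smooth1 g' & pderiv s (tens f g) = tens f' g'].
Proof.
move=> sf sg; elim: s => [|i s [f' [g' [sf' sg' /= ->]]]]; first by exists f, g.
have [->|->] := ord2P i.
  by exists (derive1 f'), g'; rewrite pderiv0_tens//; split => //; exact: smooth1_derive1.
by exists f', (derive1 g'); rewrite pderiv1_tens//; split => //; exact: smooth1_derive1.
Qed.

Lemma smooth_tens f g : smooth1 f -> smooth1 g -> smooth (tens f g).
Proof.
move=> sf sg s; have [f' [g' [sf' sg' ->]]] := pderiv_tens s sf sg; split.
  move=> z; apply: cvgM.
    by apply: (@continuous_comp _ _ _ fst f'); [exact: cvg_fst|exact: smooth1_continuous].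
  by apply: (@continuous_comp _ _ _ snd g'); [exact: cvg_snd|exact: smooth1_continuous].
move=> i z; have [->|->] := ord2P i.
  by have [] := is_derive_tens0 g' (smooth1_derivable (x := z.1) sf').
by have [] := is_derive_tens1 f' (smooth1_derivable (x := z.2) sg').
Qed.

Lemma test_function_tens (U : set (R * R)) f g (a1 b1 a2 b2 : R) :
  smooth1 f -> smooth1 g ->
  (forall x, ~~ (a1 <= x <= b1) -> f x = 0) ->
  (forall x, ~~ (a2 <= x <= b2) -> g x = 0) ->
  (forall z, a1 <= z.1 <= b1 -> a2 <= z.2 <= b2 -> U z) ->
  test_function U (tens f g).
Proof.
move=> sf sg f0 g0 KU; split; first exact: smooth_tens.
exists (`[a1, b1] `*` `[a2, b2]); split.
- by apply: compact_setX; exact: segment_compact.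
- by move=> z [] /=; rewrite !in_itv /=; exact: KU.
- move=> z /=; rewrite !in_itv /= => /not_andP[/negP/f0|/negP/g0] h;
    by rewrite /tens h (mul0r, mulr0).
Qed.

Lemma mderiv20_tens f g : smooth1 f ->
  mderiv (2, 0)%N (tens f g) = tens (derive1 (derive1 f)) g.
Proof.
by move=> sf; rewrite /mderiv /= !pderiv0_tens//; exact: smooth1_derive1.
Qed.

Lemma mderiv02_tens f g : smooth1 g ->
  mderiv (0, 2)%N (tens f g) = tens f (derive1 (derive1 g)).
Proof.
by move=> sf; rewrite /mderiv /= !pderiv1_tens//; exact: smooth1_derive1.
Qed.

Lemma mderiv11_tens f g : smooth1 f -> smooth1 g ->
  mderiv (1, 1)%N (tens f g) = tens (derive1 f) (derive1 g).
Proof. by move=> sf sg; rewrite /mderiv /= pderiv1_tens// pderiv0_tens. Qed.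

End tensor_products.

(** * One-sided bumps of a given width, and their correctors *)

Section profile.
Context {R : realType}.

Lemma derive1_locally_affine (f : R -> R) (c e x : R) (U : set R) : open U -> U x ->
  (forall y, U y -> f y = c * y + e) -> derive1 f x = c.
Proof.
move=> oU Ux fU; rewrite derive1E.
have D : is_derive x 1 (fun y : R => c * y + e) c.
  by apply: is_derive_eq; rewrite /GRing.scale /= ?(mulr1, mulr0, scaler0, scale0r, addr0, add0r, mul0r).
have [_ <-] := D.
apply: near_eq_derive; near=> y; apply: fU; near: y; exact: open_nbhs_nbhs.
Unshelve. all: by end_near. Qed.

Lemma derive1_ramp0 (x : R) : x < 0 -> derive1 ramp x = 0.
Proof.
move=> x0; apply: (@derive1_locally_affine _ 0 0 _ `]-oo, 0[) => //=.
by move=> y; rewrite /= in_itv /= => y0; rewrite ramp0 ?mul0r ?addr0// ltW.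
Qed.

Lemma derive1_ramp1 (x : R) : 1 < x -> derive1 ramp x = 1.
Proof.
move=> x0; apply: (@derive1_locally_affine _ 1 0 _ `]1, +oo[) => //=.
  by rewrite in_itv /= andbT.
by move=> y; rewrite /= in_itv /= andbT => y0; rewrite ramp1 ?mul1r ?addr0// ltW.
Qed.

Lemma derive2_ramp0 (x : R) : ~~ (0 <= x <= 1) -> derive1 (derive1 ramp) x = 0.
Proof.
rewrite negb_and -!ltNge => /orP[x0|x0].
  apply: (@derive1_locally_affine _ 0 0 _ `]-oo, 0[) => //=.
  by move=> y; rewrite /= in_itv /= => y0; rewrite derive1_ramp0 ?mul0r ?addr0.
apply: (@derive1_locally_affine _ 0 1 _ `]1, +oo[) => //=.
  by rewrite in_itv /= andbT.
by move=> y; rewrite /= in_itv /= andbT => y0; rewrite derive1_ramp1 ?mul0r ?add0r.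
Qed.

Lemma bounded_on_unit_interval (f : R -> R) : continuous f ->
  exists2 C, 0 <= C & forall x, 0 <= x <= 1 -> `|f x| <= C.
Proof.
move=> cf.
have c : {within `[0 : R, 1], continuous (fun x => `|f x|)}.
  apply: continuous_subspaceT => x; apply: continuous_comp; first exact: cf.
  exact: norm_continuous.
have [c0 _ Hc] := EVT_max ler01 c.
by exists `|f c0| => // x x01; apply: Hc; rewrite in_itv.
Qed.

Lemma derive_ramp_bounded : exists2 C : R, 1 <= C &
  forall x, `|derive1 ramp x| <= C /\ `|derive1 (derive1 ramp) x| <= C.
Proof.
have s1 := smooth1_derive1 (@smooth1_ramp R).
have [C1 C10 H1] := bounded_on_unit_interval (smooth1_continuous s1).
have [C2 C20 H2] := bounded_on_unit_interval (smooth1_continuous (smooth1_derive1 s1)).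
(* The 1 covers the constant slope beyond 1, and gives C >= 1, which later absorbs C into C^2. *)
exists (1 + C1 + C2); first by rewrite -addrA lerDl addr_ge0.
move=> x; have [x01|x01] := boolP (0 <= x <= 1).
  by split; [have := H1 _ x01|have := H2 _ x01]; lra.
split; last by rewrite derive2_ramp0// normr0; lra.
move: x01; rewrite negb_and -!ltNge => /orP[x0|x0].
  by rewrite derive1_ramp0// normr0; lra.
by rewrite derive1_ramp1// normr1; lra.
Qed.

(* [sg = 1] or [sg = -1] tells on which side of [a] the support lies. *)
Variable sg : R.
Hypothesis sgE : sg ^+ 2 = 1.

(** The factors make [prof1] and [prof2] the first two derivatives of [prof0], since sg^2 = 1, and
    make [prof0] equal to x - a past the support of the bump, whatever the width and the side. *)
Definition prof0 (d a x : R) : R := sg * d * ramp (sg / d * (x - a)).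
Definition prof1 (d a x : R) : R := derive1 ramp (sg / d * (x - a)).
Definition prof2 (d a x : R) : R := sg / d * derive1 (derive1 ramp) (sg / d * (x - a)).

Lemma sg_cases : sg = 1 \/ sg = -1.
Proof. by move/eqP: sgE; rewrite sqrf_eq1 => /orP[/eqP|/eqP]; [left|right]. Qed.

Lemma smooth1_prof0 d a : smooth1 (prof0 d a).
Proof.
move=> n; apply: (@CnM _ _ (cst (sg * d))); first exact: Cn_cst.
by apply: (@Cn_affine _ _ ramp); exact: smooth1_ramp.
Qed.

Lemma smooth1_prof1 d a : smooth1 (prof1 d a).
Proof.
move=> n; apply: (@Cn_affine _ _ (derive1 ramp)).
by apply: smooth1_derive1; exact: smooth1_ramp.
Qed.

Lemma smooth1_prof2 d a : smooth1 (prof2 d a).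
Proof.
move=> n; apply: (@CnM _ _ (cst (sg / d))); first exact: Cn_cst.
apply: (@Cn_affine _ _ (derive1 (derive1 ramp))).
by do 2 apply: smooth1_derive1; exact: smooth1_ramp.
Qed.

Lemma is_derive_prof0 d a (x : R) : d != 0 -> is_derive x 1 (prof0 d a) (prof1 d a x).
Proof.
move=> d0.
have D := is_derive_affine (smooth1_is_derive (sg / d * (x - a)) smooth1_ramp).
have sgd : sg * d * (sg / d) = 1 by rewrite -sgE; field.
have := is_deriveZ (sg * d) D; congr is_derive.
by rewrite /GRing.scale /= mulrA sgd mul1r.
Qed.

Lemma is_derive_prof1 d a (x : R) : is_derive x 1 (prof1 d a) (prof2 d a x).
Proof.
exact: (is_derive_affine (smooth1_is_derive (sg / d * (x - a))
  (smooth1_derive1 smooth1_ramp))).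
Qed.

Lemma derive1_prof1 d a : derive1 (prof1 d a) = prof2 d a.
Proof.
by apply/funext => x; rewrite derive1E; have [_ ->] := is_derive_prof1 d a x.
Qed.

Lemma prof2_eq0 d a x : 0 < d -> ~~ (0 <= sg * (x - a) <= d) -> prof2 d a x = 0.
Proof.
move=> d0 h; rewrite /prof2 derive2_ramp0 ?mulr0//; apply: contra h.
by rewrite mulrAC ler_pdivlMr// mul0r ler_pdivrMr// mul1r.
Qed.

Lemma Rintegral_prof2 d a : 0 < d -> `|\int[@lebesgue_measure R]_x prof2 d a x| = 1.
Proof.
move=> d0.
(* The margin 2 d places both endpoints strictly outside the transition zone, where the slope of
   [ramp] is known to be 0 or 1. *)
have lt : a - 2 * d < a + 2 * d by lra.
have -> : \int[@lebesgue_measure R]_x prof2 d a x =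
    \int[@lebesgue_measure R]_(x in `[a - 2 * d, a + 2 * d]) prof2 d a x.
  rewrite [RHS]Rintegral_mkcond; apply: eq_Rintegral => x _.
  rewrite patchE; case: ifPn => //; rewrite notin_setE /= in_itv /= => /negP xa.
  apply: prof2_eq0 => //; apply: contra xa.
  by case: sg_cases => ->; rewrite ?mul1r ?mulN1r; lra.
rewrite /Rintegral (continuous_FTC2 (F := prof1 d a) lt); first last.
- by move=> x _; rewrite derive1_prof1.
- have cp := smooth1_continuous (smooth1_prof1 d a).
  split.
  + by move=> x _; apply: smooth1_derivable; exact: smooth1_prof1.
  + by apply: cvg_at_right_filter; exact: cp.
  + by apply: cvg_at_left_filter; exact: cp.
- by apply: continuous_subspaceT => x; apply: smooth1_continuous; exact: smooth1_prof2.
rewrite -EFinB /= /prof1.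
have -> : a + 2 * d - a = 2 * d by ring.
have -> : a - 2 * d - a = - (2 * d) by ring.
have -> : sg / d * (2 * d) = 2 * sg by field; rewrite gt_eqF.
have -> : sg / d * - (2 * d) = - (2 * sg) by field; rewrite gt_eqF.
case: sg_cases => ->.
  by rewrite mulr1 derive1_ramp1 ?derive1_ramp0 ?subr0 ?normr1//; lra.
by rewrite mulrN1 opprK derive1_ramp0 ?derive1_ramp1 ?sub0r ?normrN ?normr1//; lra.
Qed.

Definition corr0 (d h a x : R) : R := prof0 d a x - prof0 h a x.
Definition corr1 (d h a x : R) : R := prof1 d a x - prof1 h a x.

Lemma smooth1_corr0 d h a : smooth1 (corr0 d h a).
Proof.
by move=> n; apply: CnD; [exact: smooth1_prof0|apply: CnN; exact: smooth1_prof0].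
Qed.

Lemma smooth1_corr1 d h a : smooth1 (corr1 d h a).
Proof.
by move=> n; apply: CnD; [exact: smooth1_prof1|apply: CnN; exact: smooth1_prof1].
Qed.

Lemma derive1_corr0 d h a : d != 0 -> h != 0 -> derive1 (corr0 d h a) = corr1 d h a.
Proof.
move=> d0 h0; apply/funext => x; rewrite derive1E.
by have [_ ->] := is_deriveB (is_derive_prof0 a x d0) (is_derive_prof0 a x h0).
Qed.

Lemma derive1_corr1 d h a x : derive1 (corr1 d h a) x = prof2 d a x - prof2 h a x.
Proof.
rewrite derive1E.
by have [_ ->] := is_deriveB (is_derive_prof1 d a x) (is_derive_prof1 h a x).
Qed.

(** On one side of the support both profiles vanish; on the other both equal x - a and cancel. *)
Lemma corr0_eq0 d h a x : 0 < d -> d <= h -> ~~ (0 <= sg * (x - a) <= h) ->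
  corr0 d h a x = 0.
Proof.
move=> d0 dh; have h0 : 0 < h by exact: lt_le_trans dh.
rewrite negb_and -!ltNge /corr0 /prof0 => /orP[s0|s0].
  by rewrite !ramp0 ?mulr0 ?subrr// mulrAC ler_pdivrMr// mul0r ltW.
rewrite !ramp1.
- rewrite !mulrA (_ : sg * d * sg / d = sg ^+ 2); last by field; rewrite gt_eqF.
  rewrite (_ : sg * h * sg / h = sg ^+ 2) ?subrr//; by field; rewrite gt_eqF.
- by rewrite mulrAC ler_pdivlMr// mul1r ltW.
- by rewrite mulrAC ler_pdivlMr// mul1r (le_trans dh)// ltW.
Qed.

Lemma corr1_eq0 d h a x : 0 < d -> d <= h -> ~~ (0 <= sg * (x - a) <= h) ->
  corr1 d h a x = 0.
Proof.
move=> d0 dh; have h0 : 0 < h by exact: lt_le_trans dh.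
rewrite negb_and -!ltNge /corr1 /prof1 => /orP[s0|s0].
  by rewrite !derive1_ramp0 ?subrr// mulrAC ltr_pdivrMr// mul0r.
rewrite !derive1_ramp1 ?subrr//.
- by rewrite mulrAC ltr_pdivlMr// mul1r.
- by rewrite mulrAC ltr_pdivlMr// mul1r (le_lt_trans dh).
Qed.

Lemma normr_sg : `|sg| = 1.
Proof. by case: sg_cases => ->; rewrite ?normrN normr1. Qed.

Lemma prof0_le d a x : 0 < d -> `|prof0 d a x| <= `|x - a|.
Proof.
move=> d0; have := ramp_norm (sg / d * (x - a)); rewrite /prof0.
move: (ramp _) => t; rewrite !normrM normr_sg !mul1r normfV (gtr0_norm d0) => h.
by rewrite mulrC -ler_pdivlMr// mulrC.
Qed.

(** |[ramp] x| <= |x| rescales to a bound by |x - a| for every width, so nothing depends on d. *)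
Lemma corr0_le d h a x : 0 < d -> d <= h -> `|corr0 d h a x| <= 2 * h.
Proof.
move=> d0 dh; have h0 : 0 < h by exact: lt_le_trans dh.
have [s|s] := boolP (0 <= sg * (x - a) <= h); last first.
  by rewrite corr0_eq0// normr0 mulr_ge0// ltW.
have xa : `|x - a| <= h.
  by move: s; case: sg_cases => ->; rewrite ler_norml; lra.
rewrite (le_trans (ler_normB _ _))// mulr_natl mulr2n lerD//.
  exact: le_trans (prof0_le _ _ d0) xa.
exact: le_trans (prof0_le _ _ h0) xa.
Qed.

Lemma corr1_le C d h a x : (forall x, `|derive1 (@ramp R) x| <= C) ->
  `|corr1 d h a x| <= 2 * C.
Proof.
by move=> hC; rewrite (le_trans (ler_normB _ _))// mulr_natl mulr2n lerD// hC.
Qed.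

Lemma prof2_le C d a x : (forall x, `|derive1 (derive1 (@ramp R)) x| <= C) ->
  0 < d -> `|prof2 d a x| <= C / d.
Proof.
move=> hC d0; rewrite !normrM normr_sg mul1r normfV (gtr0_norm d0) mulrC.
by apply: ler_wpM2r; rewrite ?invr_ge0 ?hC// ltW.
Qed.

End profile.

(** * Estimates on the strip *)

Section square_integrable.
Context {R : realType}.
Local Notation TT := (measurableTypeR R * measurableTypeR R)%type.
Implicit Types (F psi : R * R -> R).

Definition L2norm F : R := fine ('N[leb2]_2%:E [EFin \o F])%E.

Lemma L2normE F : F \in Lfun leb2 2%:E -> ('N[leb2]_2%:E [EFin \o F])%E = (L2norm F)%:E.
Proof.
rewrite inE => /andP[_]; rewrite inE /= /finite_norm => Foo.
by rewrite /L2norm fineK// ge0_fin_numE ?Lnorm_ge0.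
Qed.

Lemma L2norm_ge0 F : 0 <= L2norm F.
Proof. by rewrite fine_ge0// Lnorm_ge0. Qed.

Lemma L2_measurable F : F \in Lfun leb2 2%:E -> measurable_fun (setT : set TT) F.
Proof. by rewrite inE => /andP[]; rewrite inE. Qed.

Lemma L2norm_bounded_support (A : set (R * R)) psi (c v : R) :
  measurable (A : set TT) -> leb2 A = v%:E -> 0 <= c ->
  measurable_fun (setT : set TT) psi ->
  (forall z, `|psi z| <= c) -> (forall z, ~ A z -> psi z = 0) ->
  ('N[leb2]_2%:E [EFin \o psi] <= (c * Num.sqrt v)%:E)%E.
Proof.
move=> mA Av c0 mpsi psic psi0.
have v0 : 0 <= v by rewrite -lee_fin -Av.
have mpsi2 : measurable_fun (setT : set TT) (fun z => `|(EFin \o psi) z| `^ 2)%E.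
  apply: (measurableT_comp (measurable_poweR 2)) => //.
  apply: measurableT_comp => //; exact/measurable_EFinP.
rewrite unlock /Lnorm.
have mcst : measurable_fun (setT : set TT) ((cst (c ^+ 2)%:E : TT -> \bar R) \_ A).
  apply: (measurable_restrictT (T1 := TT) (cst (c ^+ 2)%:E : TT -> \bar R) mA).1.
  exact: measurable_cst.
have le : (\int[leb2]_z `|(EFin \o psi) z| `^ 2 <= (c ^+ 2 * v)%:E)%E.
  rewrite EFinM -Av -(integral_cst leb2 mA).
  rewrite [leRHS]integral_mkcond.
  apply: ge0_le_integral => //; first by move=> z _; exact: poweR_ge0.
  move=> z _; rewrite patchE; case: ifPn => zA /=; rewrite lee_fin.
    by rewrite powR_mulrn// lerXn2r ?nnegrE.
  by rewrite psi0 ?normr0 ?powR0//; rewrite notin_setE in zA.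
have I0 : (0 <= \int[leb2]_z `|(EFin \o psi) z| `^ 2)%E.
  by apply: integral_ge0 => z _; exact: poweR_ge0.
apply: (@le_trans _ _ (((c ^+ 2 * v)%:E) `^ (2^-1))%E).
  apply: gt0_ler_poweR => //.
    rewrite in_itv /= leey andbT.
    exact: I0.
  by rewrite in_itv /= leey andbT lee_fin mulr_ge0// exprn_ge0.
rewrite poweR_EFin powR12_sqrt ?mulr_ge0 ?exprn_ge0//.
by rewrite sqrtrM ?exprn_ge0// sqrtr_sqr ger0_norm.
Qed.

Lemma L2_mul_bounded_support (A : set (R * R)) F psi (c v : R) :
  F \in Lfun leb2 2%:E ->
  measurable (A : set TT) -> leb2 A = v%:E -> 0 <= c ->
  measurable_fun (setT : set TT) psi ->
  (forall z, `|psi z| <= c) -> (forall z, ~ A z -> psi z = 0) ->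
  leb2.-integrable setT (EFin \o (fun z => F z * psi z)) /\
  `|\int[leb2]_z (F z * psi z)| <= c * Num.sqrt v * L2norm F.
Proof.
move=> LF mA Av c0 mpsi psic psi0.
have N2 := L2norm_bounded_support mA Av c0 mpsi psic psi0.
have mF := L2_measurable LF.
have mFpsi : measurable_fun (setT : set TT) (F \* psi) by exact: measurable_funM.
have H : ('N[leb2]_1 [EFin \o (F \* psi)%R] <= (c * Num.sqrt v * L2norm F)%:E)%E.
  have half : 2^-1 + 2^-1 = 1 :> R by rewrite [RHS]splitr mul1r.
  rewrite (le_trans (hoelder leb2 mF mpsi _ _ half))// L2normE// mulrC EFinM.
  by rewrite lee_wpmul2l// lee_fin L2norm_ge0.
rewrite Lnorm1 in H.
have iFpsi : leb2.-integrable setT (EFin \o (fun z => F z * psi z)).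
  apply/integrableP; split; first exact/measurable_EFinP.
  by apply: le_lt_trans H _; rewrite ltry.
split => //; rewrite -lee_fin; apply: le_trans H.
rewrite EFin_normr_Rintegral//.
by apply: le_abse_integral => //; exact/measurable_EFinP.
Qed.

Lemma leb2_rectangle (a1 b1 a2 b2 : R) : a1 <= b1 -> a2 <= b2 ->
  leb2 (`[a1, b1] `*` `[a2, b2]) = ((b1 - a1) * (b2 - a2))%:E.
Proof.
move=> ab1 ab2.
have E (a b : R) : a <= b -> @lebesgue_measure R `[a, b] = (b - a)%:E.
  move=> ab; rewrite lebesgue_measure_itv /= lte_fin.
  by case: ltgtP ab => // -> _; rewrite subrr.
transitivity (@lebesgue_measure R `[a1, b1] * @lebesgue_measure R `[a2, b2])%E.
  exact: product_measure1E.
by rewrite !E.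
Qed.

Lemma measurable_tens (f g : R -> R) : continuous f -> continuous g ->
  measurable_fun (setT : set TT) (tens f g).
Proof.
move=> cf cg; apply: measurable_funM.
  by apply: (measurableT_comp (f := f)) => //; exact: continuous_measurable_fun.
by apply: (measurableT_comp (f := g)) => //; exact: continuous_measurable_fun.
Qed.

(** Cauchy-Schwarz on a square of side h: the factor h is the square root of its area. *)
Lemma L2_mul_tens F (f g : R -> R) (a1 a2 h c1 c2 : R) : F \in Lfun leb2 2%:E ->
  0 <= h -> 0 <= c1 -> 0 <= c2 -> continuous f -> continuous g ->
  (forall x, `|f x| <= c1) -> (forall y, `|g y| <= c2) ->
  (forall x, ~~ (a1 <= x <= a1 + h) -> f x = 0) ->
  (forall y, ~~ (a2 <= y <= a2 + h) -> g y = 0) ->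
  leb2.-integrable setT (EFin \o (fun z => F z * tens f g z)) /\
  `|\int[leb2]_z (F z * tens f g z)| <= c1 * c2 * h * L2norm F.
Proof.
move=> LF h0 c10 c20 cf cg fc gc f0 g0.
have -> : c1 * c2 * h = c1 * c2 * Num.sqrt (h * h) by rewrite -expr2 sqrtr_sqr ger0_norm.
apply: (@L2_mul_bounded_support (`[a1, a1 + h] `*` `[a2, a2 + h])) => //.
- exact: measurableX.
- by rewrite leb2_rectangle ?lerDl// !(addrAC _ h) !subrr !add0r.
- exact: mulr_ge0.
- exact: measurable_tens.
- by move=> z; rewrite normrM ler_pM.
- move=> z; rewrite /= !in_itv /= => /not_andP[/negP/f0|/negP/g0] e;
    by rewrite /tens e (mul0r, mulr0).
Qed.

End square_integrable.

Section strip.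
Context {R : realType}.
Local Notation TT := (measurableTypeR R * measurableTypeR R)%type.
Implicit Types (f g : R * R -> R).

(** Even order removes the sign, and extension by 0 turns integrals over the strip into integrals
    over the plane. *)
Lemma Rintegral_wderiv (a : nat * nat) f g phi : ~~ odd (a.1 + a.2) ->
  is_wderiv a f g -> test_function Omega phi ->
  \int[leb2]_z ((f \_ Omega) z * mderiv a phi z) = \int[leb2]_z ((g \_ Omega) z * phi z).
Proof.
move=> a2 [_ _ /(_ phi)] + tphi => /(_ tphi).
rewrite -signr_odd (negbTE a2) expr0 mul1r.
rewrite Rintegral_mkcond [X in _ = X -> _]Rintegral_mkcond => E.
transitivity (\int[leb2]_z ((fun z => f z * mderiv a phi z) \_ Omega) z).
  by apply: eq_Rintegral => z _; rewrite !patchE; case: ifP; rewrite ?mul0r.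
rewrite E; apply: eq_Rintegral => z _.
by rewrite !patchE; case: ifP; rewrite ?mul0r.
Qed.

(** The left end a - (1 - sg) / 2 * h is a for sg = 1 and a - h for sg = -1, which writes both
    orientations as one interval. *)
Lemma signed_support (sg a h y : R) : sg ^+ 2 = 1 ->
  ~~ (a - (1 - sg) / 2 * h <= y <= a - (1 - sg) / 2 * h + h) ->
  ~~ (0 <= sg * (y - a) <= h).
Proof. by move=> /sg_cases[->|->]; apply: contra => ?; lra. Qed.

Lemma bump_family (sg C : R) : sg ^+ 2 = 1 ->
  (forall x, `|derive1 (derive1 (@ramp R)) x| <= C) ->
  let psi q n := prof2 sg n.+1%:R^-1 q in
  [/\ forall q n, measurable_fun setT (psi q n),
      forall q n y, `|psi q n y| <= C * n.+1%:R,
      forall q n y, n.+1%:R^-1 < `|q - y| -> psi q n y = 0 &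
      forall q n, `|\int[@lebesgue_measure R]_y psi q n y| = 1].
Proof.
move=> sgE hC /=; split.
- by move=> q n; apply: continuous_measurable_fun; apply/smooth1_continuous/smooth1_prof2.
- move=> q n y; have := @prof2_le R sg sgE C n.+1%:R^-1 q y hC.
  by rewrite invrK; apply; rewrite invr_gt0.
- move=> q n y; move: (n.+1%:R^-1) (invr_gt0 (n.+1%:R : R)) => d.
  rewrite ltr0Sn => d0 qy; apply: prof2_eq0 => //; apply/negP => h.
  move: qy; apply/negP; rewrite -leNgt ler_norml.
  by move: h; case/sg_cases : sgE => ->; lra.
- by move=> q n; apply: Rintegral_prof2 => //; rewrite invr_gt0.
Qed.

(** An L^2 function on a strip of infinite measure need not be integrable, so f is first cut off to
    bounded rectangles, with no effect on pairings with bumps supported inside them. *)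
Lemma ae_le_of_profiles f (M h : R) : 0 < h -> h <= 1 / 3 ->
  f \_ Omega \in Lfun leb2 2%:E ->
  (forall sg a1 a2 d1 d2 : R, sg ^+ 2 = 1 -> 0 < d1 <= h -> 0 < d2 <= h ->
     (forall y : R, 0 <= sg * (y - a2) <= h -> 0 < y < 1) ->
     `|\int[leb2]_z ((f \_ Omega) z * tens (prof2 1 d1 a1) (prof2 sg d2 a2) z)| <= M) ->
  {ae leb2, forall z, Omega z -> `|f z| <= M}.
Proof.
move=> h0 h3 LF HM; set F := f \_ Omega in LF HM *.
have [C C1 hC] := @derive_ramp_bounded R.
have {}hC x : `|derive1 (derive1 (@ramp R)) x| <= C by have [] := hC x.
have one2 : 1 ^+ 2 = 1 :> R by rewrite expr1n.
pose n0 := Num.truncn h^-1.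
have n0P n : (n0 <= n)%N -> 0 < (n.+1%:R^-1 : R) <= h.
  move=> n0n; rewrite invr_gt0 ltr0Sn /= invf_ple ?posrE//.
  by rewrite (le_trans (ltW (truncnS_gt _)))// ler_nat ltnS.
(* One unit wider than the range -N < x < N of the centres, so that it contains every bump of width
   at most 1/3. *)
pose A (N : nat) : set TT := `[- N.+1%:R, N.+1%:R] `*` `[0, 1].
have mA N : measurable (A N) by exact: measurableX.
pose FN N z := F z * \1_(A N) z.
have iFN N : leb2.-integrable setT (EFin \o FN N).
  have N0 : 0 <= N.+1%:R :> R by [].
  have AN : leb2 (A N) = ((N.+1%:R - - N.+1%:R) * (1 - 0) : R)%:E.
    by apply: leb2_rectangle => //; lra.
  apply: (L2_mul_bounded_support LF (mA N) AN ler01 _ _ _).1.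
  - exact: measurable_indic.
  - by move=> z; rewrite indicE; case: (_ \in _); rewrite ?normr1// normr0.
  - by move=> z Az; rewrite indicE memNset.
have key (sg lo hi : R) : sg ^+ 2 = 1 ->
    (forall a2 y : R, lo < a2 < hi -> 0 <= sg * (y - a2) <= h -> 0 < y < 1) ->
    forall N, {ae leb2, forall z, - N%:R < z.1 < N%:R -> lo < z.2 < hi -> `|FN N z| <= M}.
  move=> sgE lohi N.
  have [mphi phib phi0 phi1] := bump_family one2 hC.
  have [mpsi psib psi0 psi1] := bump_family sgE hC.
  apply: (ae_le_approx2 mphi phib phi0 phi1 mpsi psib psi0 psi1 (N := n0) (iFN N)).
  move=> q1 q2 n1 n2 q1N q2ab n1n n2n.
  have d1 := n0P _ n1n; have d2 := n0P _ n2n.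
  have supp := lohi _ ^~ q2ab.
  have := HM sg (ratr q1) (ratr q2) _ _ sgE d1 d2 supp.
  congr (`| _ | <= _); apply: eq_Rintegral => z _.
  rewrite /FN -/(tens (prof2 1 n1.+1%:R^-1 (ratr q1)) (prof2 sg n2.+1%:R^-1 (ratr q2)) z).
  rewrite indicE; have [zA|zA] := boolP (z \in A N); first by rewrite mulr1.
  rewrite mulr0 mul0r /tens.
  have /andP[d1p d1h] := d1; have /andP[d2p d2h] := d2.
  have [z1|z1] := boolP (0 <= 1 * (z.1 - ratr q1) <= n1.+1%:R^-1); last first.
    by rewrite prof2_eq0// mul0r mulr0.
  have [z2|z2] := boolP (0 <= sg * (z.2 - ratr q2) <= n2.+1%:R^-1); last first.
    by rewrite (prof2_eq0 (sg := sg) d2p z2) !mulr0.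
  exfalso; move: zA; rewrite notin_setE; apply; split; rewrite /= in_itv /=.
    rewrite -natr1; move: q1N z1 d1h h3; move: (_^-1) (ratr _) => u v; lra.
  have /andP[? ?] : 0 < z.2 < 1.
    apply: supp; move: z2 => /andP[-> /= z2]; exact: le_trans d2h.
  by rewrite !ltW.
(* Upward bumps centred below 2/3 and downward bumps centred above 1/3 stay in the strip as h <=
   1/3; the two ranges cover it. *)
have Kp := key 1 0 (2 / 3) one2; have Km := key (- 1) (1 / 3) 1.
have {}Kp := Kp ltac:(by move=> *; lra).
have {}Km := Km ltac:(by rewrite sqrrN expr1n) ltac:(by move=> *; lra).
have := ae_conj (ae_foralln Kp) (ae_foralln Km).
move/ae_mono; apply => z [Hp Hm] zO.
pose N := (Num.truncn `|z.1|).+1.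
have zN : - N%:R < z.1 < N%:R by rewrite -ltr_norml truncnS_gt.
have -> : f z = FN N z.
  rewrite /FN indicE /F patchE !mem_set ?mulr1//.
  move: zO; rewrite /Omega /= => /andP[z0 z1]; split => /=; rewrite in_itv /=.
    by rewrite -natr1; move: zN; lra.
  by rewrite !ltW.
move: zO; rewrite /Omega /= => zO.
have [z2|z2] := ltP z.2 (2 / 3).
  by apply: Hp => //; lra.
by apply: Hm => //; lra.
Qed.

(** * The pairing with a narrow bump, uniformly in its widths *)

Section estimate.
Variables (f fxx fxy fyy : R * R -> R) (A B C h : R).
Hypothesis Dxx : is_wderiv (2, 0)%N f fxx.
Hypothesis Dxy : is_wderiv (1, 1)%N f fxy.
Hypothesis Dyy : is_wderiv (0, 2)%N f fyy.
Hypothesis Lf : f \_ Omega \in Lfun leb2 2%:E.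
Hypothesis Lxx : fxx \_ Omega \in Lfun leb2 2%:E.
Hypothesis Lxy : fxy \_ Omega \in Lfun leb2 2%:E.
Hypothesis Lyy : fyy \_ Omega \in Lfun leb2 2%:E.
Hypothesis fA : L2norm (f \_ Omega) <= A.
Hypothesis fxxB : L2norm (fxx \_ Omega) <= B.
Hypothesis fxyB : L2norm (fxy \_ Omega) <= B.
Hypothesis fyyB : L2norm (fyy \_ Omega) <= B.
Hypothesis C1 : 1 <= C.
Hypothesis hC : forall x, `|derive1 (@ramp R) x| <= C /\ `|derive1 (derive1 (@ramp R)) x| <= C.
Hypothesis h0 : 0 < h.

(* With [m] and [n] profiles of width [h] and correctors [s], [t], the narrow
   profiles are [m + s''] and [n + t'']; the second derivatives of the cross
   terms are moved onto [f], and the last one is shared as [s''t'' = (s't')_xy]. *)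
Lemma profile_pairing_le (sg a1 a2 d1 d2 : R) : sg ^+ 2 = 1 ->
  0 < d1 <= h -> 0 < d2 <= h ->
  (forall y : R, 0 <= sg * (y - a2) <= h -> 0 < y < 1) ->
  `|\int[leb2]_z ((f \_ Omega) z * tens (prof2 1 d1 a1) (prof2 sg d2 a2) z)| <=
  8 * C ^+ 2 * (A / h + h * B).
Proof.
move=> sgE /andP[d10 d1h] /andP[d20 d2h] supp.
have one2 : 1 ^+ 2 = 1 :> R by rewrite expr1n.
have [hC1 hC2] : (forall x, `|derive1 (@ramp R) x| <= C) /\
  (forall x, `|derive1 (derive1 (@ramp R)) x| <= C).
  by split => x; have [] := hC x.
have C0 : 0 <= C by exact: le_trans ler01 C1.
have hn0 : h != 0 by rewrite gt_eqF.
have d1n0 : d1 != 0 by rewrite gt_eqF.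
have d2n0 : d2 != 0 by rewrite gt_eqF.
have Ch0 : 0 <= C / h by rewrite divr_ge0// ltW.
pose m := prof2 1 h a1. pose n := prof2 sg h a2.
pose s0 := corr0 1 d1 h a1. pose s1 := corr1 1 d1 h a1. pose s2 : R -> R := derive1 s1.
pose t0 := corr0 sg d2 h a2. pose t1 := corr1 sg d2 h a2. pose t2 : R -> R := derive1 t1.
have sm : smooth1 m by exact: smooth1_prof2.
have sn : smooth1 n by exact: smooth1_prof2.
have ss0 : smooth1 s0 by exact: smooth1_corr0.
have ss1 : smooth1 s1 by exact: smooth1_corr1.
have ss2 : smooth1 s2 by exact: smooth1_derive1.
have st0 : smooth1 t0 by exact: smooth1_corr0.
have st1 : smooth1 t1 by exact: smooth1_corr1.
have st2 : smooth1 t2 by exact: smooth1_derive1.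
have s0E : derive1 s0 = s1 by exact: derive1_corr0.
have t0E : derive1 t0 = t1 by exact: derive1_corr0.
have s2E x : s2 x = prof2 1 d1 a1 x - m x by exact: derive1_corr1.
have t2E x : t2 x = prof2 sg d2 a2 x - n x by exact: derive1_corr1.
pose lo (sg a : R) := a - (1 - sg) / 2 * h.
have suppS (e a : R) : e ^+ 2 = 1 -> forall y, ~~ (lo e a <= y <= lo e a + h) ->
   ~~ (0 <= e * (y - a) <= h) by move=> eE y; exact: signed_support.
have m0 x : ~~ (lo 1 a1 <= x <= lo 1 a1 + h) -> m x = 0.
  by move=> /(suppS _ _ one2); exact: prof2_eq0.
have n0 x : ~~ (lo sg a2 <= x <= lo sg a2 + h) -> n x = 0.
  by move=> /(suppS _ _ sgE); exact: prof2_eq0.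
have s00 x : ~~ (lo 1 a1 <= x <= lo 1 a1 + h) -> s0 x = 0.
  by move=> /(suppS _ _ one2); exact: corr0_eq0.
have t00 x : ~~ (lo sg a2 <= x <= lo sg a2 + h) -> t0 x = 0.
  by move=> /(suppS _ _ sgE); exact: corr0_eq0.
have s10 x : ~~ (lo 1 a1 <= x <= lo 1 a1 + h) -> s1 x = 0.
  by move=> /(suppS _ _ one2); exact: corr1_eq0.
have t10 x : ~~ (lo sg a2 <= x <= lo sg a2 + h) -> t1 x = 0.
  by move=> /(suppS _ _ sgE); exact: corr1_eq0.
have narrow (e a d x : R) : e ^+ 2 = 1 -> 0 < d <= h -> ~~ (lo e a <= x <= lo e a + h) ->
    prof2 e d a x = 0.
  move=> eE /andP[d0 dh] /(suppS _ _ eE) hx; apply: prof2_eq0 => //.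
  by apply: contra hx => /andP[-> /= ?]; exact: le_trans dh.
have s20 x : ~~ (lo 1 a1 <= x <= lo 1 a1 + h) -> s2 x = 0.
  by move=> hx; rewrite s2E m0// narrow ?subrr// d10.
have t20 x : ~~ (lo sg a2 <= x <= lo sg a2 + h) -> t2 x = 0.
  by move=> hx; rewrite t2E n0// narrow ?subrr// d20.
have mb x : `|m x| <= C / h by exact: prof2_le.
have nb x : `|n x| <= C / h by exact: prof2_le.
have s0b x : `|s0 x| <= 2 * h by exact: corr0_le.
have t0b x : `|t0 x| <= 2 * h by exact: corr0_le.
have s1b x : `|s1 x| <= 2 * C by exact: corr1_le.
have t1b x : `|t1 x| <= 2 * C by exact: corr1_le.
(* This bound and the next blow up with the narrow widths; they serve only to split the integral
   into four integrable terms. *)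
have s2b x : `|s2 x| <= C / d1 + C / h.
  rewrite s2E; apply: (le_trans (ler_normB _ _)); apply: lerD; last exact: mb.
  exact: (@prof2_le _ _ one2 _ _ _ _ hC2 d10).
have t2b x : `|t2 x| <= C / d2 + C / h.
  rewrite t2E; apply: (le_trans (ler_normB _ _)); apply: lerD; last exact: nb.
  exact: (@prof2_le _ _ sgE _ _ _ _ hC2 d20).
have s2b0 : 0 <= C / d1 + C / h by rewrite addr_ge0// divr_ge0// ltW.
have t2b0 : 0 <= C / d2 + C / h by rewrite addr_ge0// divr_ge0// ltW.
have h2 : 0 <= 2 * h by rewrite mulr_ge0// ltW.
have C2 : 0 <= 2 * C by rewrite mulr_ge0.
have inO z : lo 1 a1 <= z.1 <= lo 1 a1 + h -> lo sg a2 <= z.2 <= lo sg a2 + h -> Omega z.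
  move=> _ z2; apply: supp; move: z2; rewrite /lo.
  by case/sg_cases : sgE => ->; lra.
have test (g k : R -> R) : smooth1 g -> smooth1 k ->
    (forall x, ~~ (lo 1 a1 <= x <= lo 1 a1 + h) -> g x = 0) ->
    (forall x, ~~ (lo sg a2 <= x <= lo sg a2 + h) -> k x = 0) ->
    test_function Omega (tens g k).
  by move=> sg0 sk g0 k0; apply: test_function_tens g0 k0 inO.
pose cts := @smooth1_continuous R.
have s1E : derive1 s1 = s2 := erefl.
have t1E : derive1 t1 = t2 := erefl.
clearbody s2 t2 s1 t1 s0 t0 m n.
have [i1 b1] := L2_mul_tens Lf (ltW h0) Ch0 Ch0 (cts _ sm) (cts _ sn) mb nb m0 n0.
have [i2 _] := L2_mul_tens Lf (ltW h0) Ch0 t2b0 (cts _ sm) (cts _ st2) mb t2b m0 t20.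
have [i3 _] := L2_mul_tens Lf (ltW h0) s2b0 Ch0 (cts _ ss2) (cts _ sn) s2b nb s20 n0.
have [i4 _] := L2_mul_tens Lf (ltW h0) s2b0 t2b0 (cts _ ss2) (cts _ st2) s2b t2b s20 t20.
have [_ b2] := L2_mul_tens Lyy (ltW h0) Ch0 h2 (cts _ sm) (cts _ st0) mb t0b m0 t00.
have [_ b3] := L2_mul_tens Lxx (ltW h0) h2 Ch0 (cts _ ss0) (cts _ sn) s0b nb s00 n0.
have [_ b4] := L2_mul_tens Lxy (ltW h0) C2 C2 (cts _ ss1) (cts _ st1) s1b t1b s10 t10.
have E2 : \int[leb2]_z ((f \_ Omega) z * tens m t2 z) = \int[leb2]_z ((fyy \_ Omega) z * tens m t0 z).
  rewrite -(Rintegral_wderiv _ Dyy (test _ _ sm st0 m0 t00))//.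
  rewrite (mderiv02_tens m st0) t0E t1E; exact: erefl.
have E3 : \int[leb2]_z ((f \_ Omega) z * tens s2 n z) = \int[leb2]_z ((fxx \_ Omega) z * tens s0 n z).
  rewrite -(Rintegral_wderiv _ Dxx (test _ _ ss0 sn s00 n0))//.
  rewrite (mderiv20_tens n ss0) s0E s1E; exact: erefl.
have E4 : \int[leb2]_z ((f \_ Omega) z * tens s2 t2 z) = \int[leb2]_z ((fxy \_ Omega) z * tens s1 t1 z).
  rewrite -(Rintegral_wderiv _ Dxy (test _ _ ss1 st1 s10 t10))//.
  rewrite (mderiv11_tens ss1 st1) s1E t1E; exact: erefl.
have -> : \int[leb2]_z ((f \_ Omega) z * tens (prof2 1 d1 a1) (prof2 sg d2 a2) z) =
    \int[leb2]_z ((f \_ Omega) z * tens m n z) + \int[leb2]_z ((f \_ Omega) z * tens m t2 z) +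
    (\int[leb2]_z ((f \_ Omega) z * tens s2 n z) + \int[leb2]_z ((f \_ Omega) z * tens s2 t2 z)).
  rewrite -(RintegralD4 i1 i2 i3 i4); apply: eq_Rintegral => z _.
  rewrite /tens s2E t2E.
  move: ((f \_ Omega) z) (m z.1) (n z.2) (prof2 1 _ _ _) (prof2 sg _ _ _) => v0 v1 v2 v3 v4.
  by ring.
rewrite E2 E3 E4.
set I1 := Rintegral _ _ _ in b1 *; set I2 := Rintegral _ _ _ in b2 *.
set I3 := Rintegral _ _ _ in b3 *; set I4 := Rintegral _ _ _ in b4 *.
have N1 : `|I1| <= C ^+ 2 * (A / h).
  apply: (le_trans b1); rewrite (_ : C / h * (C / h) * h = C ^+ 2 / h); last by field.
  by rewrite -mulrA ler_wpM2l ?exprn_ge0// mulrC ler_wpM2r// invr_ge0 ltW.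
have CC : C <= C ^+ 2 by rewrite expr2 ler_peMl.
have B0 : 0 <= h * B by exact: mulr_ge0 (ltW h0) (le_trans (L2norm_ge0 _) fxxB).
have A0 : 0 <= A / h by exact: divr_ge0 (le_trans (L2norm_ge0 _) fA) (ltW h0).
have N2 : `|I2| <= 2 * C * (h * B).
  apply: (le_trans b2); rewrite (_ : C / h * (2 * h) * h = 2 * C * h); last by field.
  by rewrite -mulrA ler_wpM2l// ler_wpM2l// ltW.
have N3 : `|I3| <= 2 * C * (h * B).
  apply: (le_trans b3); rewrite (_ : 2 * h * (C / h) * h = 2 * C * h); last by field.
  by rewrite -mulrA ler_wpM2l// ler_wpM2l// ltW.
have N4 : `|I4| <= 4 * C ^+ 2 * (h * B).
  apply: (le_trans b4); rewrite (_ : 2 * C * (2 * C) * h = 4 * C ^+ 2 * h); last by ring.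
  by rewrite -mulrA ler_wpM2l ?mulr_ge0 ?exprn_ge0// ler_wpM2l// ltW.
have N : `|I1 + I2 + (I3 + I4)| <= `|I1| + `|I2| + (`|I3| + `|I4|).
  by rewrite (le_trans (ler_normD _ _))// lerD// ler_normD.
(* The four terms contribute C^2 to A / h and 2 C + 2 C + 4 C^2 <= 8 C^2 to h B, whence the constant
   8. *)
apply: (le_trans N).
have CB : C * (h * B) <= C ^+ 2 * (h * B) by rewrite ler_wpM2r.
have CA : 0 <= C ^+ 2 * (A / h) by rewrite mulr_ge0// exprn_ge0.
move: N1 N2 N3 N4 CB CA; rewrite -!mulrA mulrDr.
move: `|I1| `|I2| `|I3| `|I4| => j1 j2 j3 j4.
move: (C * (h * B)) (C ^+ 2 * (h * B)) (C ^+ 2 * (A / h)) => u v w; lra.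
Qed.

End estimate.
End strip.

(** * The inequality for one component, then for the vector field *)

Section agmon.
Context {R : realType}.
Local Notation TT := (measurableTypeR R * measurableTypeR R)%type.
Implicit Types (f g : R * R -> R).

Lemma measurable_Omega : measurable (Omega : set TT).
Proof.
rewrite (_ : Omega = setT `*` `]0, 1[); first exact: measurableX.
by apply/seteqP; split => z /=; rewrite /Omega /= in_itv //= => -[].
Qed.

Lemma is_wderiv_L2 a f g : is_wderiv a f g -> (LpnormO 2%:E g < +oo)%E ->
  g \_ Omega \in Lfun leb2 2%:E.
Proof.
move=> [_ [mg _] _] goo; rewrite inE; apply/andP; split; rewrite inE //=.
exact: (measurable_restrictT (T1 := TT) g measurable_Omega).1.
Qed.

Lemma test_function_prof2 (sg a1 a2 d1 d2 : R) : sg ^+ 2 = 1 -> 0 < d1 -> 0 < d2 ->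
  (forall y : R, 0 <= sg * (y - a2) <= d2 -> 0 < y < 1) ->
  test_function Omega (tens (prof2 1 d1 a1) (prof2 sg d2 a2)).
Proof.
move=> sgE d10 d20 supp; have one2 : 1 ^+ 2 = 1 :> R by rewrite expr1n.
apply: (@test_function_tens _ _ _ _ (a1 - (1 - 1) / 2 * d1) (a1 - (1 - 1) / 2 * d1 + d1)
    (a2 - (1 - sg) / 2 * d2) (a2 - (1 - sg) / 2 * d2 + d2)).
- exact: smooth1_prof2.
- exact: smooth1_prof2.
- by move=> x /(signed_support one2); exact: prof2_eq0.
- by move=> x /(signed_support sgE); exact: prof2_eq0.
- move=> z _ z2; apply: supp; move: z2.
  by case/sg_cases : sgE => ->; lra.
Qed.

Lemma integrable_L2_prof2 f (sg a1 a2 d1 d2 : R) : sg ^+ 2 = 1 -> 0 < d1 -> 0 < d2 ->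
  f \in Lfun leb2 2%:E ->
  leb2.-integrable setT (EFin \o (fun z => f z * tens (prof2 1 d1 a1) (prof2 sg d2 a2) z)).
Proof.
move=> sgE d10 d20 Lf; have one2 : 1 ^+ 2 = 1 :> R by rewrite expr1n.
have [C C1 hC] := @derive_ramp_bounded R.
have hC2 x : `|derive1 (derive1 (@ramp R)) x| <= C by have [] := hC x.
have C0 : 0 <= C by exact: le_trans ler01 C1.
pose h := Num.max d1 d2.
have h1 : d1 <= h by rewrite le_max lexx.
have h2 : d2 <= h by rewrite le_max lexx orbT.
have h0 : 0 <= h by rewrite (le_trans (ltW d10)).
pose cts := @smooth1_continuous R.
apply: (L2_mul_tens (a1 := a1 - (1 - 1) / 2 * h) (a2 := a2 - (1 - sg) / 2 * h)
  (c1 := C / d1) (c2 := C / d2) Lf h0 _ _ _ _ _ _ _ _).1.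
- by rewrite divr_ge0// ltW.
- by rewrite divr_ge0// ltW.
- by apply: cts; exact: smooth1_prof2.
- by apply: cts; exact: smooth1_prof2.
- by move=> x; exact: (@prof2_le _ _ one2 _ _ _ _ hC2 d10).
- by move=> x; exact: (@prof2_le _ _ sgE _ _ _ _ hC2 d20).
- move=> x /(signed_support one2) hx; apply: prof2_eq0 => //.
  by apply: contra hx => /andP[-> /= ?]; exact: le_trans h1.
- move=> x /(signed_support sgE) hx; apply: prof2_eq0 => //.
  by apply: contra hx => /andP[-> /= ?]; exact: le_trans h2.
Qed.

(** f - g pairs to 0 with every bump, so the bound holds with M = 0. The result is needed because
    the term of order 0 in [Hnorm] involves a chosen representative and not f itself. *)
Lemma wderiv0_ae_eq f g : is_wderiv (0, 0)%N f g ->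
  f \_ Omega \in Lfun leb2 2%:E -> g \_ Omega \in Lfun leb2 2%:E ->
  {ae leb2, forall z, (f \_ Omega) z = (g \_ Omega) z}.
Proof.
move=> fg Lf Lg.
have E : (f \- g) \_ Omega = f \_ Omega - g \_ Omega.
  by apply/funext => z; rewrite !fctE !patchE; case: ifP; rewrite ?subr0.
have Lfg : (f \- g) \_ Omega \in Lfun leb2 2%:E.
  have p1 : (1 <= 2%:E :> \bar R)%E by rewrite lee_fin ler1n.
  have [_ addc] := @Lfun_addr_closed _ _ R leb2 2%:E p1.
  by rewrite E; apply: addc => //; exact: Lfun_oppr_closed.
have h3 : 0 < 1 / 3 :> R by rewrite divr_gt0.
have H := ae_le_of_profiles (M := 0) h3 (lexx _) Lfg.
apply: (ae_mono (H _)); last first.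
  move=> z Hz; rewrite !patchE; case: ifPn => // zO.
  have := Hz (set_mem zO); rewrite normr_le0 /= subr_eq0 => /eqP; exact.
move=> sg a1 a2 d1 d2 sgE /andP[d10 d1h] /andP[d20 d2h] supp.
have supp2 (y : R) : 0 <= sg * (y - a2) <= d2 -> 0 < y < 1.
  by move=> /andP[y0 yd]; apply: supp; rewrite y0 (le_trans yd).
have T := test_function_prof2 a1 sgE d10 d20 supp2.
have := @Rintegral_wderiv R (0, 0)%N _ _ _ isT fg T.
rewrite /mderiv /= => Efg.
have i1 := integrable_L2_prof2 a1 a2 sgE d10 d20 Lf.
have i2 := integrable_L2_prof2 a1 a2 sgE d10 d20 Lg.
rewrite (_ : \int[leb2]_z _ = 0) ?normr0//.
transitivity (\int[leb2]_z ((f \_ Omega) z * tens (prof2 1 d1 a1) (prof2 sg d2 a2) z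
   - (g \_ Omega) z * tens (prof2 1 d1 a1) (prof2 sg d2 a2) z)).
  by apply: eq_Rintegral => z _; rewrite E !fctE mulrBl.
by rewrite (RintegralB measurableT i1 i2) Efg subrr.
Qed.

Lemma ae_eq_Lnorm2 f g : measurable_fun (setT : set TT) f ->
  measurable_fun (setT : set TT) g -> {ae leb2, forall z, f z = g z} ->
  ('N[leb2]_2%:E [EFin \o f] = 'N[leb2]_2%:E [EFin \o g])%E.
Proof.
move=> mf mg fg.
have m (k : R * R -> R) : measurable_fun (setT : set TT) k ->
    measurable_fun (setT : set TT) (fun z => `|(EFin \o k) z| `^ 2)%E.
  move=> mk; apply: (measurableT_comp (measurable_poweR 2)) => //.
  apply: measurableT_comp => //; exact/measurable_EFinP.
have E : (\int[leb2]_z `|(EFin \o f) z| `^ 2 = \int[leb2]_z `|(EFin \o g) z| `^ 2)%E.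
  apply: ae_eq_integral => //; [exact: m|exact: m|].
  by apply: (ae_mono fg) => z fgz _ /=; rewrite fgz.
by rewrite unlock /Lnorm E.
Qed.

Lemma le_sqrte (x s : \bar R) : (0 <= x -> x ^+ 2 <= s -> x <= sqrte s)%E.
Proof.
case: x => [x||]//; case: s => [s||]//=; rewrite ?leey//.
rewrite !lee_fin -expr2 => x0 xs.
by rewrite -(ger0_norm x0) -sqrtr_sqr ler_wsqrtr.
Qed.

Lemma sqre_ge0 (x : \bar R) : (0 <= x ^+ 2)%E.
Proof. by case: x => [x||]//=; rewrite lee_fin -expr2 sqr_ge0. Qed.

Lemma le_Hnorm m (i j : nat) f : (i + j <= m)%N ->
  (LpnormO 2%:E (wderiv (i, j) f) <= Hnorm m f)%E.
Proof.
move=> ijm; have im : (i < m.+1)%N by rewrite ltnS (leq_trans (leq_addr _ _) ijm).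
have jm : (j < m.+1)%N by rewrite ltnS (leq_trans (leq_addl _ _) ijm).
apply: le_sqrte; first exact: Lnorm_ge0.
rewrite (bigD1 (Ordinal im))//= (bigD1 (Ordinal jm))//= -addeA leeDl// adde_ge0//.
  by apply: sume_ge0 => *; exact: sqre_ge0.
by apply: sume_ge0 => k _; apply: sume_ge0 => *; exact: sqre_ge0.
Qed.

Lemma agmon : exists2 K : R, 0 < K & forall f, sobolevH 2 f ->
  {ae leb2, forall z, Omega z ->
    (((f z) ^+ 2)%:E <= K%:E * LpnormO 2%:E f * Hnorm 2 f)%E}.
Proof.
have [C C1 hC] := @derive_ramp_bounded R.
have C0 : 0 < C by exact: lt_le_trans ltr01 C1.
(* With a = r^2 b and h = r / 3, the sum a / h + h b is (3 + 1/3) r b, and (r b)^2 = a b. *)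
exists ((8 * C ^+ 2 * (3 + 1 / 3)) ^+ 2).
  by rewrite exprn_gt0// mulr_gt0// mulr_gt0// exprn_gt0.
set K := _ ^+ 2.
have K0 : 0 < K by rewrite exprn_gt0// mulr_gt0// mulr_gt0// exprn_gt0.
move=> f [Lf Df].
have W (i j : nat) : (i + j <= 2)%N -> is_wderiv (i, j) f (wderiv (i, j) f).
  move=> ij; apply: (@xgetPex _ (fun=> 0) [set g | is_wderiv (i, j) f g]).
  by have [g] := Df (i, j) ij; exists g.
rewrite /L2 in Lf.
have NfE : LpnormO 2%:E f = (L2norm (f \_ Omega))%:E by exact: L2normE.
(* This case is separated before an infinite [Hnorm] is considered, since 0 times [+oo] is 0. *)
have [f0|fn0] := eqVneq (LpnormO 2%:E f) 0%E.
  have mf := L2_measurable Lf.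
  have mE : measurable_fun (setT : set TT) (EFin \o (f \_ Omega)).
    exact/measurable_EFinP.
  have p0 : (0 < 2%:E :> \bar R)%E by rewrite lte_fin.
  apply: (ae_mono (Lnorm_eq0_eq0 mE p0 f0)) => z /(_ I) /= [fz] zO.
  move: fz; rewrite patchE mem_set// => ->.
  by rewrite f0 mule0 mul0e expr0n.
(* [sobolevH] gives some square integrable weak derivative, while [Hnorm] measures the chosen one;
   its square integrability is read off from finiteness of the norm. *)
have [Hoo|Hoo] := eqVneq (Hnorm 2 f) +oo%E.
  apply: aeW => z _; rewrite Hoo gt0_muley ?leey//.
  by rewrite mule_gt0// lt_neqAle eq_sym fn0 Lnorm_ge0.
have H0 : (0 <= Hnorm 2 f)%E by exact: sqrte_ge0.
pose b := fine (Hnorm 2 f).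
have bE : Hnorm 2 f = b%:E by rewrite fineK// ge0_fin_numE// ltey.
have LW (i j : nat) : (i + j <= 2)%N ->
    (wderiv (i, j) f) \_ Omega \in Lfun leb2 2%:E /\
    L2norm ((wderiv (i, j) f) \_ Omega) <= b.
  move=> ij; have le := le_Hnorm f ij.
  have L : (wderiv (i, j) f) \_ Omega \in Lfun leb2 2%:E.
    by apply: is_wderiv_L2 (W _ _ ij) _; rewrite (le_lt_trans le)// bE ltry.
  by split=> //; rewrite -lee_fin -bE -L2normE.
have [L00 b00] := LW 0%N 0%N isT.
have [L20 b20] := LW 2%N 0%N isT.
have [L11 b11] := LW 1%N 1%N isT.
have [L02 b02] := LW 0%N 2%N isT.
set a := L2norm (f \_ Omega) in NfE.
(* This gives r <= 1, so that the width r / 3 is admissible. *)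
have ab : a <= b.
  rewrite (le_trans _ b00)// -lee_fin -!L2normE//.
  rewrite (ae_eq_Lnorm2 (L2_measurable Lf) (L2_measurable L00))//.
  exact: wderiv0_ae_eq (W 0%N 0%N isT) Lf L00.
have a0 : 0 < a.
  by rewrite lt_neqAle L2norm_ge0 andbT eq_sym; move: fn0; rewrite NfE eqe.
have b0 : 0 < b by exact: lt_le_trans ab.
pose r := Num.sqrt (a / b).
have r0 : 0 < r by rewrite sqrtr_gt0 divr_gt0.
have r1 : r <= 1 by rewrite -sqrtr1 ler_wsqrtr// ler_pdivrMr// mul1r.
have aE : a = r ^+ 2 * b by rewrite sqr_sqrtr ?divr_ge0 ?ltW// divfK// gt_eqF.
have h0 : 0 < r / 3 by rewrite divr_gt0.
have h3 : r / 3 <= 1 / 3 by rewrite ler_pM2r// invr_gt0.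
have P := profile_pairing_le (W 2%N 0%N isT) (W 1%N 1%N isT) (W 0%N 2%N isT)
  Lf L20 L11 L02 (lexx a) b20 b11 b02 C1 hC h0.
have := ae_le_of_profiles h0 h3 Lf (fun sg a1 a2 d1 d2 => @P sg a1 a2 d1 d2).
move=> H; apply: (ae_mono H) => z Hz zO.
rewrite NfE bE -!EFinM lee_fin.
have -> : K * a * b = (8 * C ^+ 2 * (a / (r / 3) + r / 3 * b)) ^+ 2.
  by rewrite /K aE; field; rewrite gt_eqF.
rewrite -[(f z) ^+ 2]real_normK ?num_real// lerXn2r ?nnegrE//; last exact: Hz.
exact: le_trans (Hz zO).
Qed.

End agmon.

Theorem corollary3p12 (R : realType) (mu k0 k1 : R) (hmu : 0 < mu) :
  exists2 C : R, 0 < C &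
    forall u : vfield R, spaceW mu k0 k1 u ->
      (vLinftynorm u ^+ 2 <= C%:E * vL2norm u * vH2norm u)%E.
Proof.
have [K K0 HK] := @agmon R.
(* The factor 2 counts the components: |u|^2 is a sum of two squares, each bounded with the constant
   K. *)
exists (2 * K); first by rewrite mulr_gt0.
move=> u [_ Hu _].
have L0 := sqrte_ge0 (\sum_i LpnormO 2%:E (u i) ^+ 2)%E.
have N0 := sqrte_ge0 (\sum_i Hnorm 2 (u i) ^+ 2)%E.
have comp i : {ae leb2, forall z, Omega z ->
    (((u i z) ^+ 2)%:E <= K%:E * vL2norm u * vH2norm u)%E}.
  apply: (ae_mono (HK (u i) (Hu i))) => z Hz zO.
  apply: (le_trans (Hz zO)); apply: lee_pmul.
  - by apply: mule_ge0; [rewrite lee_fin ltW|exact: Lnorm_ge0].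
  - exact: sqrte_ge0.
  - rewrite lee_pmul2l//; apply: le_sqrte; first exact: Lnorm_ge0.
    by rewrite (bigD1 i)//= leeDl// sume_ge0// => *; exact: sqre_ge0.
  - apply: le_sqrte; first exact: sqrte_ge0.
    by rewrite (bigD1 i)//= leeDl// sume_ge0// => *; exact: sqre_ge0.
rewrite EFinM -!muleA [X in (_ <= _ * X)%E]muleA.
set S := (K%:E * _ * _)%E in comp *.
have S0 : (0 <= S)%E by rewrite !mule_ge0// lee_fin ltW.
have [->|Soo] := eqVneq S +oo%E; first by rewrite gt0_muley ?leey.
have SE : S = (fine S)%:E by rewrite fineK// ge0_fin_numE// ltey.
have s0 : 0 <= fine S by rewrite fine_ge0.
have le : (vLinftynorm u <= (Num.sqrt (2 * fine S))%:E)%E.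
  (* The norm of exponent [+oo] is an essential supremum, with default value 0 when the whole space
     is null. *)
  rewrite /vLinftynorm /LpnormO unlock /Lnorm; case: ifPn => _; last first.
    by rewrite lee_fin sqrtr_ge0.
  apply/ess_supP.
  apply: (ae_mono (ae_conj (comp ord0) (comp ord_max))) => z [H0 H1] /=.
  rewrite lee_fin patchE; case: ifPn => zO; last by rewrite normr0 sqrtr_ge0.
  rewrite ger0_norm ?sqrtr_ge0// ler_wsqrtr//.
  have := H0 (set_mem zO); have := H1 (set_mem zO); rewrite SE !lee_fin.
  rewrite big_ord_recl big_ord1 (_ : lift ord0 ord0 = ord_max); last exact/val_inj.
  by rewrite mulr_natl mulr2n => h1 h0; rewrite lerD.
have l0 : (0 <= vLinftynorm u)%E by exact: Lnorm_ge0.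
rewrite SE -EFinM.
move: l0 le; case: (vLinftynorm u) => [l||]//=.
rewrite !lee_fin -expr2 => l0 ll.
by rewrite -[leRHS]sqr_sqrtr ?mulr_ge0// lerXn2r ?nnegrE.
Qed.
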